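(* Let $\omega=\omega(n)$ satisfy $\omega\to\infty$ and $\omega=o(\log n)$ as $n\to\infty$, let $p=\frac{\log n+\omega}{n}$, and let $G=G(n,p)$. Let $Z_1$ be the number of vertices of degree $1$ in $G$ and let $L=\frac{\log n}{\log\log n}$. Then, with high probability, $$rc(G)\sim \max\{Z_1,L\}.$$ That is, for every fixed $\delta>0$, the probability that $G$ is connected and $(1-\delta)\max\{Z_1,L\}\le rc(G)\le(1+\delta)\max\{Z_1,L\}$ tends to $1$ as $n\to\infty$.
   Context: $G(n,p)$ is the binomial random graph on vertex set $[n]=\{1,\dots,n\}$, in which each of the $\binom n2$ possible edges is present independently with probability $p$. An edge-colored graph (the coloring is arbitrary, not necessarily proper) is rainbow edge connected if any two vertices are joined by a path whose edges have pairwise distinct colors. For a connected graph $G$, the rainbow connectivity $rc(G)$ is the smallest number of colors in an edge coloring of $G$ that makes $G$ rainbow edge connected. ''With high probability'' means with probability tending to $1$ as $n\to\infty$. $A\sim B$ means $A=(1+o(1))B$ as $n\to\infty$. All logarithms are natural. *)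

(* Defs.v *)
From HB Require Import structures.
From mathcomp Require Import all_boot all_order all_algebra.
From mathcomp Require Import all_classical all_reals all_analysis.

Set Implicit Arguments.
Unset Strict Implicit.
Unset Printing Implicit Defensive.
Import Order.TTheory GRing.Theory Num.Theory.
Import numFieldNormedType.Exports.
Local Open Scope ring_scope.

(* A simple graph on the finite vertex type V is represented by its edge set
   E \subset pairs V. *)
Definition pairs (V : finType) : {set {set V}} := [set e : {set V} | #|e| == 2%N].

Definition adj (V : finType) (E : {set {set V}}) : rel V :=
  fun x y => [set x; y] \in E.

Definition degree (V : finType) (E : {set {set V}}) (x : V) : nat :=
  #|[set y | adj E x y]|.

Definition num_deg1 (V : finType) (E : {set {set V}}) : nat :=
  #|[set x | degree E x == 1%N]|.

Definition connected_graph (V : finType) (E : {set {set V}}) : bool :=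
  [forall x, forall y, connect (adj E) x y].

(* [rainbow_path E c x y s]: the vertex sequence x :: s is a path of the graph
   from x to y, and the list of the colours of its consecutive edges has no
   repetition.  Only the values of c on E matter. *)
Definition rainbow_path (V : finType) (E : {set {set V}}) (c : {set V} -> nat)
    (x y : V) (s : seq V) : bool :=
  [&& path (adj E) x s, uniq (x :: s), last x s == y
    & uniq (pairmap (fun u v => c [set u; v]) x s)].

Definition rainbow_connected (V : finType) (E : {set {set V}})
    (c : {set V} -> nat) : Prop :=
  forall x y : V, exists s : seq V, rainbow_path E c x y s.

(* An edge colouring with k colours takes its values on E in {0, ..., k-1}. *)
Definition rainbow_colorable (V : finType) (E : {set {set V}}) (k : nat) :
    Prop :=
  exists c : {set V} -> nat,
    (forall e, e \in E -> (c e < k)%N) /\ rainbow_connected E c.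

Definition is_rc (V : finType) (E : {set {set V}}) (r : nat) : Prop :=
  rainbow_colorable E r /\ forall k, rainbow_colorable E k -> (r <= k)%N.

(* The rainbow connectivity; the value 0 is a dummy when the graph is not
   connected (see [rcP] for the connected case). *)
Definition rc (V : finType) (E : {set {set V}}) : nat :=
  xget 0%N [set r | is_rc E r]%classic.

(* The law of G(n, p): each pair is an edge with probability p, independently.
   This is a probability only when 0 <= p <= 1. *)
Definition gnp_weight (R : realType) (n : nat) (p : R)
    (E : {set {set 'I_n}}) : R :=
  \prod_(e in pairs 'I_n) (if e \in E then p else 1 - p).

Definition gnp_prob (R : realType) (n : nat) (p : R)
    (A : {set {set 'I_n}} -> Prop) : R :=
  \sum_(E in powerset (pairs 'I_n) | `[< A E >]) gnp_weight p E.

Lemma gnp_prob_total (R : realType) (n : nat) (p : R) :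
  gnp_prob (n := n) p (fun=> True) = 1.
Proof.
pose F e : R := if e \in pairs 'I_n then p else 0.
pose G e : R := if e \in pairs 'I_n then 1 - p else 1.
have : \prod_e (F e + G e) = 1.
  by apply: big1 => e _; rewrite /F /G; case: ifP => _; rewrite ?add0r // subrKC.
rewrite bigA_distr /gnp_prob => <-.
rewrite [RHS](bigID (fun E : {set {set 'I_n}} => E \subset pairs 'I_n)) /= [X in _ + X]big1 ?addr0.
  apply: eq_big => [E|E]; first by rewrite powersetE asboolT ?andbT // inE.
  rewrite powersetE => /andP[/fintype.subsetP sE _].
  rewrite /gnp_weight big_mkcond /=; apply: eq_bigr => e _.
  rewrite /F /G; case: (boolP (e \in pairs _)) => // /negP np.
  by case: ifP => // /sE.
move=> E /subsetPn[e eE np].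
by rewrite (bigD1 e) //= eE /F (negbTE np) mul0r.
Qed.

Lemma uniq_pairmap_edge (V : finType) (x : V) (s : seq V) :
  uniq (x :: s) -> uniq (pairmap (fun u v => [set u; v]) x s).
Proof.
elim: s x => //= y s IH x /andP[]; rewrite inE negb_or => /andP[xy xs] ys.
rewrite IH ?andbT //.
have H : forall z t, x \notin z :: t ->
    forall e, e \in pairmap (fun u v : V => [set u; v]) z t -> x \notin e.
  move=> z t; elim: t z => //= w t IHt z; rewrite !inE !negb_or.
  case/and3P=> xz xw xt e; rewrite inE => /orP[/eqP->|].
    by rewrite !inE negb_or xz.
  by apply: IHt; rewrite inE negb_or xw.
apply/negP => /H; rewrite inE negb_or xy xs => /(_ isT).
by rewrite !inE eqxx.
Qed.

Lemma rcP (V : finType) (E : {set {set V}}) : connected_graph E -> is_rc E (rc E).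
Proof.
move=> /forallP conE.
have ex : exists k, `[< rainbow_colorable E k >].
  exists #|E|; apply/asboolP; exists (fun e => index e (enum E)); split.
    by move=> e eE; rewrite cardE index_mem mem_enum.
  move=> x y; have /forallP/(_ y)/connectP[s0 ps0 ys0] := conE x.
  move: ys0; case/shortenP: ps0 => s ps us _ ys.
  exists s; rewrite /rainbow_path ps us -ys eqxx /=.
  have -> : pairmap (fun u v => index [set u; v] (enum E)) x s =
            map (index^~ (enum E)) (pairmap (fun u v => [set u; v]) x s).
    by elim: s x {ps us ys} => //= z s IH x; rewrite IH.
  rewrite map_inj_in_uniq ?uniq_pairmap_edge //.
  have sub : forall e, e \in pairmap (fun u v : V => [set u; v]) x s -> e \in E.
    elim: s x ps {us ys} => //= z s IH x /andP[xz ps] e.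
    by rewrite inE => /orP[/eqP->//|]; apply: IH.
  by move=> e f /sub eE /sub fE /index_inj; rewrite !mem_enum => ->.
suff : exists r, is_rc E r by exact: xgetPex.
exists (ex_minn ex); case: ex_minnP => m /asboolP mP min; split=> // k kP.
by apply: min; apply/asboolP.
Qed.

(* Main.v *)
(* Lower bound: the pendant edges of a rainbow connected graph have pairwise
   distinct colours, so rc >= Z_1, and a first moment count of paths shows that
   two fixed vertices are at distance at least (1 - delta) L.

   Upper bound: colour the edges uniformly at random with q ~ (1 + delta) L
   colours, then recolour the edges at vertices of small degree.  Split the
   palette into P1, P2 of size slightly more than L / 2 each and a rest P3.
   Call a vertex rich if, for EVERY sub-palette S of P1 u P2 of size at least m,
   it has at least D ~ kappa log n edges with colours in S.  Quantifying over all
   2^q = n^o(1) palettes at once makes the exploration of rainbow paths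
   deterministic: with high probability no vertex has many non-rich neighbours,
   and every set of at most 2 n^(5/8) vertices spans few edges, so the set of
   endpoints of rainbow paths with colours in S grows by a factor b of order
   log n at each step.  After about (1/2 + delta/8) L steps it has size
   N >= n^(1/2 + delta/16).  Starting from two rich vertices, one with the
   palette P1 and one with P2, the two sets of size N depend only on the labels
   in P1 u P2, while the labels in P3 remain random, so with overwhelming
   probability some edge with colour in P3 joins them.  A vertex that is not small
   reaches a rich neighbour avoiding any 3 given colours, and small vertices are
   pairwise non-adjacent and leave through a recoloured edge. *)

Require Import Defs.
From HB Require Import structures.
From mathcomp Require Import all_boot all_order all_algebra.
From mathcomp Require Import all_classical all_reals all_analysis.
From mathcomp Require Import zify ring lra.
Import Order.TTheory GRing.Theory Num.Theory.
Import numFieldNormedType.Exports.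
Set Implicit Arguments.
Unset Strict Implicit.
Unset Printing Implicit Defensive.
Local Open Scope ring_scope.

(** * Product measures on finite label spaces *)

Section ProductMeasure.
Variables (R : realType) (I T : finType) (w : T -> R).

Definition Pr (A : {ffun I -> T} -> Prop) : R :=
  \sum_(f : {ffun I -> T} | `[< A f >]) \prod_i w (f i).

Hypothesis w_ge0 : forall t, 0 <= w t.
Hypothesis w_sum1 : \sum_t w t = 1.

Lemma prod_w_ge0 (f : {ffun I -> T}) : 0 <= \prod_i w (f i).
Proof. by apply: prodr_ge0 => i _. Qed.

Lemma Pr_le A B : (forall f, A f -> B f) -> Pr A <= Pr B.
Proof.
move=> AB; rewrite /Pr big_mkcond [leRHS]big_mkcond /=.
apply: ler_sum => f _; case: asboolP => Af; case: asboolP => Bf //.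
- by case: Bf; apply: AB.
- exact: prod_w_ge0.
Qed.

Lemma Pr_true : Pr (fun=> True) = 1.
Proof.
rewrite /Pr (eq_bigl xpredT); last by move=> f; apply/asboolP.
by rewrite -(bigA_distr_bigA (fun _ : I => w)) big1.
Qed.

Lemma Pr_or A B : Pr (fun f => A f \/ B f) <= Pr A + Pr B.
Proof.
rewrite /Pr big_mkcond [X in _ <= X + _]big_mkcond [X in _ <= _ + X]big_mkcond /=.
rewrite -big_split /=; apply: ler_sum => f _.
have := prod_w_ge0 f.
case: asboolP => [[Af|Bf]|_].
- by rewrite (asboolT Af); case: asboolP => _ ?; lra.
- by rewrite (asboolT Bf); case: asboolP => _ ?; lra.
- by do 2!case: asboolP => _; lra.
Qed.

Lemma Pr_or_le A B (a b : R) : Pr A <= a -> Pr B <= b -> Pr (fun f => A f \/ B f) <= a + b.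
Proof. by move=> Aa Bb; apply: le_trans (Pr_or A B) (lerD Aa Bb). Qed.

Lemma Pr_exists (J : finType) (P : pred J) (A : J -> {ffun I -> T} -> Prop) :
  Pr (fun f => exists2 j, P j & A j f) <= \sum_(j | P j) Pr (A j).
Proof.
rewrite /Pr; under [leRHS]eq_bigr => j _ do rewrite big_mkcond /=.
rewrite exchange_big /= big_mkcond /=; apply: ler_sum => f _.
have ge0 j : 0 <= (if `[< A j f >] then \prod_i w (f i) else 0).
  by case: ifP => _ //; exact: prod_w_ge0.
case: asboolP => [[j Pj /asboolT Aj]|_]; last exact: sumr_ge0.
by rewrite (bigD1 j) //= Aj lerDl sumr_ge0.
Qed.

Lemma Pr_compl A : Pr A = 1 - Pr (fun f => ~ A f).
Proof.
apply/eqP; rewrite eq_sym subr_eq -Pr_true /Pr.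
rewrite (eq_bigl xpredT); last by move=> f; apply/asboolP.
rewrite (bigID (fun f => `[< A f >])) /=; apply/eqP; congr (_ + _).
by apply: eq_bigl => f; apply/idP/idP => [/asboolPn/asboolP|/asboolP/asboolPn].
Qed.

(** Distinct indices look at distinct coordinates, so the expectation of the product factorises.
    [h i] gathers the factors at coordinate [i]: at most one, and if there is none the sum is
    [\sum_t w t = 1]. *)
Lemma expect_prod (J : finType) (Q : pred J) (phi : J -> I) (g : J -> T -> R) :
  {in Q &, injective phi} ->
  \sum_(f : {ffun I -> T}) (\prod_i w (f i)) * \prod_(j | Q j) g j (f (phi j)) =
  \prod_(j | Q j) \sum_t w t * g j t.
Proof.
move=> inj.
pose h i t := \prod_(j | Q j && (phi j == i)) g j t.
have split_f (f : {ffun I -> T}) :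
    \prod_(j | Q j) g j (f (phi j)) = \prod_i h i (f i).
  rewrite (partition_big phi xpredT) //=; apply: eq_bigr => i _.
  by apply: eq_bigr => j /andP[_ /eqP ->].
transitivity (\sum_(f : {ffun I -> T}) \prod_i (w (f i) * h i (f i))).
  by apply: eq_bigr => f _; rewrite split_f big_split.
rewrite -(bigA_distr_bigA (fun i t => w t * h i t)) /=.
rewrite [RHS](partition_big phi xpredT) //=; apply: eq_bigr => i _.
have [[j /andP[Qj /eqP phij]]|nex] := pselect (exists j, Q j && (phi j == i)).
  have only1 : forall j', (Q j' && (phi j' == i)) = (j' == j).
    move=> j'; apply/idP/eqP => [/andP[Qj' /eqP e]|->]; last by rewrite Qj phij eqxx.
    by apply: inj => //; rewrite e.
  by rewrite /h (big_pred1 j) //; apply: eq_bigr => t _; rewrite (big_pred1 j).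
have none : forall j', (Q j' && (phi j' == i)) = false.
  by move=> j'; apply/negP => ?; apply: nex; exists j'.
rewrite /h [RHS]big_pred0 // -[RHS]w_sum1.
by apply: eq_bigr => t _; rewrite big_pred0 ?mulr1.
Qed.

(** Markov's inequality for a product of functions of distinct coordinates. Indicators [g] give the
    terms of a plain union bound; a constant weight on each hit, normalised by [C], gives Chernoff
    bounds. *)
Lemma Pr_prod_bound (J : finType) (Q : pred J) (phi : J -> I) (g : J -> T -> R)
    (C : R) (A : {ffun I -> T} -> Prop) :
  {in Q &, injective phi} -> 0 <= C -> (forall j t, Q j -> 0 <= g j t) ->
  (forall f, A f -> 1 <= C * \prod_(j | Q j) g j (f (phi j))) ->
  Pr A <= C * \prod_(j | Q j) \sum_t w t * g j t.
Proof.
move=> inj C0 g0 Ag; rewrite -(expect_prod _ inj) mulr_sumr /Pr big_mkcond /=.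
apply: ler_sum => f _.
have := prod_w_ge0 f; set W := \prod_i _ => W0.
have P0 : 0 <= \prod_(j | Q j) g j (f (phi j)) by apply: prodr_ge0 => j Qj; exact: g0.
case: asboolP => [/Ag|_]; last by rewrite !mulr_ge0.
by move=> h; rewrite mulrCA -[leLHS]mulr1; apply: ler_wpM2l.
Qed.

(* [forget] reveals only part of each coordinate; given what is revealed, the
   coordinates that map to t0 are still independent, and each of them lies in B
   with conditional probability at least the unconditional one. *)
Lemma Pr_conditional (T' : finType) (forget : T -> T') (t0 : T') (B : pred T)
    (X : {ffun I -> T'} -> {set I}) (A : {ffun I -> T} -> Prop) (C : R) :
  (forall t, B t -> forget t = t0) -> 0 <= 1 - \sum_(t | B t) w t -> 0 <= C ->
  (forall f, A f -> let h := [ffun i => forget (f i)] in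
     [/\ forall i, i \in X h -> ~~ B (f i), forall i, i \in X h -> h i = t0 &
         (1 - \sum_(t | B t) w t) ^+ #|X h| <= C]) ->
  Pr A <= C.
Proof.
move=> BF y0 C0 HA; set s := \sum_(t | B t) w t in y0 HA *.
have sge0 : 0 <= s by apply: sumr_ge0.
pose mu t' := \sum_(t | forget t == t') w t.
have mu0 t' : 0 <= mu t' by apply: sumr_ge0.
have mu1 : \sum_t' mu t' = 1.
  by rewrite -w_sum1 [RHS](partition_big forget xpredT).
have PrA : Pr A <= \sum_(h : {ffun I -> T'}) C * \prod_i mu (h i); last first.
  apply: le_trans PrA _; rewrite -mulr_sumr -(bigA_distr_bigA (fun _ : I => mu)) big1 //.
  by rewrite mulr1.
rewrite /Pr (partition_big (fun f : {ffun I -> T} => [ffun i => forget (f i)]) xpredT) //=.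
apply: ler_sum => h _.
have [[f0 /andP[/asboolP Af0 /eqP f0h]]|nex] :=
    pselect (exists f0, `[< A f0 >] && ([ffun i => forget (f0 i)] == h)); last first.
  rewrite big_pred0 ?mulr_ge0 ?prodr_ge0 // => f.
  by apply/negP => ?; apply: nex; exists f.
have [_ Xt0 hC] := HA _ Af0; rewrite f0h in Xt0 hC.
(* Given the revealed [h], the event confines coordinate [i] to the fibre of [h i], with [B] removed
   when [i] lies in [X h]. *)
pose Q i t := (forget t == h i) && ((i \in X h) ==> ~~ B t).
apply: (@le_trans _ _ (\sum_(f in family Q) \prod_i w (f i))).
  rewrite big_mkcond [leRHS]big_mkcond /=; apply: ler_sum => f _.
  case: ifP => [/andP[/asboolP Af /eqP fh]|_]; last first.
    by case: ifP => _ //; exact: prod_w_ge0.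
  rewrite ifT //; apply/familyP => i.
  have [nB _ _] := HA _ Af; rewrite fh in nB.
  rewrite unfold_in /= /Q -fh ffunE eqxx /=; apply/implyP => iX.
  by rewrite nB // -fh.
rewrite -(bigA_distr_big_dep Q (fun _ => w)) /=.
apply: (@le_trans _ _ (\prod_i ((if i \in X h then 1 - s else 1) * mu (h i)))); last first.
  rewrite big_split /= -big_mkcond /= prodr_const; apply: ler_wpM2r => //.
  exact: prodr_ge0.
apply: ler_prod => i _; rewrite sumr_ge0 //=.
rewrite /Q; case: (boolP (i \in X h)) => [iX|niX] /=; last first.
  by rewrite mul1r; under eq_bigl do rewrite andbT.
have mus : \sum_(t | (forget t == h i) && ~~ B t) w t = mu t0 - s.
  rewrite /mu (Xt0 _ iX) [in RHS](bigID B) /=.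
  have -> : \sum_(t | (forget t == t0) && B t) w t = s.
    apply: eq_bigl => t; case Bt: (B t); last by rewrite andbF.
    by rewrite (BF _ Bt) eqxx.
  by rewrite addrC addrK.
(* As [mu t0 <= 1], also [mu t0 - s <= (1 - s) * mu t0]: learning the value [t0] only raises the
   chance of [B]. *)
have mule1 : mu t0 <= 1.
  by rewrite -mu1 (bigD1 t0) //= lerDl sumr_ge0.
by rewrite mus (Xt0 _ iX); nra.
Qed.

End ProductMeasure.

(** * The random graph with randomly coloured edges *)

Definition label_weight (R : realType) (q : nat) (p : R) (t : option 'I_q) : R :=
  if t is Some _ then p / q%:R else 1 - p.

(** Labels sit on all vertex sets, so that the label space is a full product; those on sets that are
    not pairs are ignored. *)
Definition label_graph (V : finType) (q : nat) (f : {ffun {set V} -> option 'I_q}) :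
    {set {set V}} :=
  [set e in pairs V | f e].

Section LabelModel.
Variables (R : realType) (q : nat) (p : R).
Hypotheses (q_gt0 : (0 < q)%N) (p_ge0 : 0 <= p) (p_le1 : p <= 1).
Notation lw := (@label_weight R q p).

Lemma label_weight_ge0 t : 0 <= lw t.
Proof. by case: t => [c|] /=; rewrite ?subr_ge0 // divr_ge0. Qed.

Lemma sum_option (F : option 'I_q -> R) : \sum_t F t = F None + \sum_c F (Some c).
Proof.
rewrite (bigD1 None) //=; congr (_ + _).
rewrite (reindex_omap Some id) /=; last by case.
by apply: eq_bigl => c; rewrite eqxx.
Qed.

Lemma sum_weight_in (S : {set 'I_q}) :
  \sum_(t | if t is Some c then c \in S else false) lw t = p * (#|S|%:R / q%:R).
Proof.
rewrite big_mkcond sum_option /= add0r -big_mkcond /= sumr_const.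
by rewrite -[LHS]mulr_natl; ring.
Qed.

Lemma sum_some_weight : \sum_c lw (Some c) = p.
Proof.
rewrite /= sumr_const card_ord -[LHS]mulr_natl mulrCA divff ?mulr1 //.
by rewrite pnatr_eq0 -lt0n.
Qed.

Lemma label_weight_sum1 : \sum_t lw t = 1.
Proof. by rewrite sum_option sum_some_weight /= subrK. Qed.

(** Couples [G(n,p)] with a uniform edge colouring. The labellings over a given graph form a product
    set, in which an edge contributes [p], a missing pair [1 - p] and a set that is not a pair
    [1]. *)
Lemma gnp_prob_label (n : nat) (A : {set {set 'I_n}} -> Prop) :
  gnp_prob p A = Pr lw (fun f : {ffun {set 'I_n} -> option 'I_q} => A (label_graph f)).
Proof.
rewrite /gnp_prob /Pr [RHS](partition_big (@label_graph _ q)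
  (fun E => (E \in powerset (pairs 'I_n)) && `[< A E >])) /=; last first.
  move=> f ->; rewrite andbT powersetE; apply/fintype.subsetP => e.
  by rewrite inE => /andP[].
apply: eq_bigr => E /andP[]; rewrite powersetE => /fintype.subsetP sE AE.
pose Q (e : {set 'I_n}) (t : option 'I_q) := (e \in pairs 'I_n) ==> (isSome t == (e \in E)).
rewrite (eq_bigl (mem (family Q))); last first.
  move=> f; apply/andP/familyP => [[_ /eqP fE] e|h].
    by rewrite unfold_in /= /Q -fE !inE; case: (#|e| == 2%N); rewrite /= ?eqxx.
  suff fE : label_graph f = E by rewrite fE eqxx.
  apply/setP => e; have := h e; rewrite unfold_in /= /Q [LHS]inE.
  case: (boolP (e \in pairs _)) => [eP /= /eqP //|/negP ne _].
  by apply/esym/negP => /sE.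
rewrite -(bigA_distr_big_dep Q (fun _ => lw)) /gnp_weight big_mkcond /=.
apply: eq_bigr => e _; rewrite /Q.
case: ifP => _ /=; last by rewrite label_weight_sum1.
rewrite big_mkcond sum_option /= -big_mkcond.
case: (e \in E) => /=; first by rewrite add0r sum_some_weight.
by rewrite big_pred0 ?addr0.
Qed.

End LabelModel.

(** * Rainbow walks *)

Section Walks.
Variables (V : finType) (E : {set {set V}}) (c : {set V} -> nat).

(** Vertices may repeat and only the colours are recorded, so walks concatenate freely;
    [walk_rainbow] returns to simple paths. *)
Definition walk (x y : V) (cs : seq nat) : Prop :=
  exists s, [/\ path (adj E) x s, last x s = y &
                pairmap (fun u v => c [set u; v]) x s = cs].

Lemma adjC (x y : V) : adj E x y = adj E y x.
Proof. by rewrite /adj finset.setUC. Qed.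

Lemma walk_nil x : walk x x [::].
Proof. by exists [::]. Qed.

Lemma walk1 x y : adj E x y -> walk x y [:: c [set x; y]].
Proof. by move=> xy; exists [:: y]; rewrite /= xy. Qed.

Lemma walk_cat x y z cs1 cs2 : walk x y cs1 -> walk y z cs2 -> walk x z (cs1 ++ cs2).
Proof.
case=> s1 [p1 l1 <-] [s2 [p2 l2 <-]]; exists (s1 ++ s2).
by rewrite cat_path p1 l1 p2 last_cat l1 l2 pairmap_cat l1.
Qed.

Lemma walk_rev x y cs : walk x y cs -> walk y x (rev cs).
Proof.
case=> s [ps <- <-] {y cs}; elim: s x ps => [|z s IH] x /=; first by move=> _; exact: walk_nil.
case/andP=> xz ps; rewrite rev_cons -cats1; apply: walk_cat (IH _ ps) _.
by rewrite finset.setUC; apply: walk1; rewrite adjC.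
Qed.

(** Cutting a closed detour out of a walk only deletes colours, so the colours stay distinct on the
    way to a simple path. *)
Lemma walk_rainbow x y cs : walk x y cs -> uniq cs -> exists s, rainbow_path E c x y s.
Proof.
pose col := pairmap (fun u v => c [set u; v]).
suff short : forall s x, path (adj E) x s -> uniq (col x s) -> exists s',
    [/\ path (adj E) x s', uniq (x :: s'), last x s' = last x s, uniq (col x s') &
        {subset col x s' <= col x s}].
  case=> s [ps <- <-] us; have [s' [p' u' l' c' _]] := short _ _ ps us.
  by exists s'; rewrite /rainbow_path p' u' l' eqxx.
elim=> {x y cs} [|y s IH] x; first by exists [::].
rewrite /col /= -/col => /andP[xy ps] /andP[xs us].
have [s' [p' u' l' c' sub]] := IH _ ps us.
have [xin|xout] := boolP (x \in y :: s'); last first.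
  exists (y :: s'); split=> //=.
  - by rewrite xy.
  - by rewrite xout.
  - by rewrite -/col c' andbT; apply: contra xs => /sub.
  - move=> e; rewrite !inE => /orP[->//|/sub ein].
    by rewrite -/col in ein *; rewrite ein orbT.
case/splitPl: xin p' u' l' c' sub => p1 p2 lx.
rewrite cat_path last_cat lx => /andP[_ p2p] u' l'.
rewrite /col pairmap_cat lx cat_uniq -/col => /and3P[_ _ uc] sub.
exists p2; split=> //.
- move: u'; rewrite -cat_cons cat_uniq => /and3P[_ /hasPn nhas u2] /=.
  rewrite u2 andbT; apply/negP => /nhas /=; rewrite -lx mem_last //.
- by move=> e ein; rewrite inE sub ?orbT // mem_cat ein orbT.
Qed.

End Walks.

(** A path between two vertices of degree 1 uses both pendant edges, so these have different
    colours. The two edges coincide only if they form a component of their own, which a third vertex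
    rules out. *)
Lemma num_deg1_le_colors (V : finType) (E : {set {set V}}) (k : nat) :
  E \subset pairs V -> (2 < #|V|)%N -> rainbow_colorable E k -> (num_deg1 E <= k)%N.
Proof.
move=> /fintype.subsetP Ep V3 [c [ck rainbow]].
have irr x : ~~ adj E x x.
  by apply/negP => /Ep; rewrite inE finset.setUid cards1.
have deg1 u w w' : degree E u == 1%N -> adj E u w -> adj E u w' -> w = w'.
  move=> /cards1P[z Ez] uw uw'.
  have: w \in [set y | adj E u y] by rewrite inE.
  have: w' \in [set y | adj E u y] by rewrite inE.
  by rewrite Ez !inE => /eqP -> /eqP ->.
pose nb u := odflt u [pick w | adj E u w].
have nbP u : degree E u == 1%N -> adj E u (nb u).
  rewrite /nb; case: pickP => //= none; rewrite /degree eq_card0 // => w.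
  by rewrite inE none.
have nb_eq u w : degree E u == 1%N -> adj E u w -> w = nb u.
  by move=> du uw; apply: deg1 (du) uw (nbP _ du).
case: k ck => [|k] ck.
  rewrite leqn0 cards_eq0; apply/eqP/setP => u; rewrite !inE.
  by apply/negbTE/negP => /nbP /ck.
pose g u : 'I_k.+1 := inord (c [set u; nb u]).
rewrite -[k.+1]card_ord /num_deg1 -(card_in_imset (f := g)) ?max_card //.
move=> u v; rewrite !inE => du dv /(congr1 val) /=.
rewrite !inordK; [|by apply/ck/nbP..] => eqc; apply/eqP/negPn/negP => uv.
have [s /and4P[ps us /eqP ls cs]] := rainbow u v.
case: s ps us ls cs => [|w s] /=; first by move=> _ _ e; rewrite e eqxx in uv.
case/andP=> uw ps us ls /andP[nc _]; have Ew := nb_eq _ _ du uw.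
case/lastP: s ps us ls nc => [|s z] /=.
  move=> _ _ wv _; rewrite wv in uw Ew.
  have Eu : u = nb v by apply: nb_eq => //; rewrite adjC.
  (* Here [u] and [v] are each other's only neighbour, so no path leads from [u] to a third
     vertex. *)
  have [z] : exists z, z \notin [set u; v].
    apply/existsP; rewrite -negb_forall; apply/negP => /forallP allV.
    have : (#|V| <= #|[set u; v]|)%N by apply/subset_leq_card/fintype.subsetP => z _.
    by rewrite cards2 uv => /(leq_trans V3).
  rewrite !inE negb_or => /andP[zu zv].
  have [s /and4P[ps us /eqP ls _]] := rainbow u z.
  case: s ps us ls => [|w1 [|w2 s]] /=.
  - by move=> _ _ e; rewrite e eqxx in zu.
  - by rewrite andbT => uw1 _ e; rewrite -e (nb_eq _ _ du uw1) -Ew eqxx in zv.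
  - case/and3P=> uw1 w12 _; rewrite (nb_eq _ _ du uw1) -Ew in w12 *.
    by rewrite (nb_eq _ _ dv w12) -Eu !inE eqxx orbT.
rewrite rcons_path last_rcons => /andP[_ lz] _ zv; rewrite {z}zv in lz *.
rewrite -cats1 pairmap_cat mem_cat negb_or /= inE => /andP[_].
have -> : last w s = nb v by rewrite -(nb_eq v (last w s)) // adjC.
by rewrite Ew eqc [X in _ == c X]finset.setUC eqxx.
Qed.

(** * Growth of coloured neighbourhoods *)

Lemma subset_of_card (T : finType) (A : {set T}) (n : nat) :
  (n <= #|A|)%N -> exists2 B : {set T}, B \subset A & #|B| = n.
Proof.
move=> nA; exists [set x in take n (enum A)].
  by apply/fintype.subsetP => x; rewrite inE => /mem_take; rewrite mem_enum.
rewrite cardsE (card_uniqP _) ?take_uniq ?enum_uniq //.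
by rewrite size_takel // -cardE.
Qed.

Lemma card_pairs_sum (T : finType) (P : rel T) :
  #|[set e : T * T | P e.1 e.2]| = (\sum_u #|[set w | P u w]|)%N.
Proof.
rewrite -sum1_card (eq_bigl (fun e => P e.1 e.2)); last by move=> e; rewrite inE.
rewrite -(pair_big_dep xpredT P (fun _ _ => 1%N)) /=; apply: eq_bigr => u _.
by rewrite -sum1_card; apply: eq_bigl => w; rewrite inE.
Qed.

Section ColouredGrowth.
Variables (V : finType) (q : nat).
Implicit Types (f : {set V} -> option 'I_q) (S P : {set 'I_q}).

(** Singletons carry labels too, hence the test [u != w]. *)
Definition cadj f S : rel V :=
  fun u w => (u != w) && (if f [set u; w] is Some c then c \in S else false).

Definition cdeg f S u : nat := #|[set w | cadj f S u w]|.

Definition rich f P (m D : nat) (u : V) : bool :=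
  [forall S : {set 'I_q}, (S \subset P) && (m <= #|S|)%N ==> (D <= cdeg f S u)%N].

Definition colours f (x : V) (s : seq V) : seq (option 'I_q) :=
  pairmap (fun u v => f [set u; v]) x s.

(** Vertices may repeat, only colours must differ. Every vertex after [x] is rich, so that the walk
    can be extended once more. *)
Definition reach f P (m D : nat) S (i : nat) (x : V) : {set V} :=
  [set w | [exists s : i.-tuple V, [&& path (cadj f S) x s, all (rich f P m D) s,
     last x s == w & uniq (colours f x s)]]].

Lemma cadj_sub f S S' u w : S \subset S' -> cadj f S u w -> cadj f S' u w.
Proof.
move=> /fintype.subsetP sS; rewrite /cadj => /andP[-> /=].
by case: (f _) => // c; exact: sS.
Qed.

Variables (f : {set V} -> option 'I_q) (P : {set 'I_q}) (m D K K' k b M : nat).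

Hypothesis poor_nbrs : forall u,
  (#|[set w | cadj f [set: 'I_q] u w && ~~ rich f P m D w]| <= K')%N.
Hypothesis sparse : forall U : {set V}, (#|U| <= M)%N ->
  (#|[set e : V * V | [&& e.1 \in U, e.2 \in U & cadj f [set: 'I_q] e.1 e.2]]| <= 2 * K * #|U|)%N.
Hypotheses (K_gt0 : (0 < K)%N) (b_gt0 : (0 < b)%N)
  (branch : (2 * K * b.+1 + K' <= D)%N) (room : (2 * b ^ k <= M)%N).

(** A walk of length [i < k] has used at most [i] colours, so the richness of its end applies to the
    rest of the palette and gives [D] neighbours, at most [K'] of them poor. If the next level [W]
    had fewer than [b ^ i.+1] vertices, [U :|: W] would span at least [2 * K * b.+1 * b ^ i] ordered
    pairs, against sparsity. *)
Lemma reach_growth S x i : rich f P m D x -> S \subset P -> (k + m <= #|S|)%N -> (i <= k)%N ->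
  (b ^ i <= #|reach f P m D S i x|)%N.
Proof.
move=> xrich SP Ssize; elim: i => [_|i IH ik].
  rewrite expn0 card_gt0; apply/set0Pn; exists x; rewrite inE.
  by apply/existsP; exists [tuple]; rewrite /= eqxx.
(* Exactly [b ^ i] vertices are kept, so that [U :|: W] stays within the size [M] of the sparsity
   hypothesis. *)
have [U sU cU] := subset_of_card (IH (ltnW ik)).
set W := reach _ _ _ _ _ i.+1 x.
have out u : u \in U -> (D <= K' + #|[set w in W | cadj f [set: 'I_q] u w]|)%N.
  move=> /(fintype.subsetP sU); rewrite inE => /existsP[s /and4P[ps rs /eqP ls us]].
  pose A := [set c | Some c \in colours f x s].
  have cA : (#|A| <= i)%N.
    rewrite -[leqRHS](size_tuple s) -(size_pairmap (fun u v => f [set u; v]) x s).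
    apply: (leq_trans (n := #|[set c | c \in pmap id (colours f x s)]|)).
      apply/subset_leq_card/fintype.subsetP => c; rewrite !inE => cc.
      by rewrite mem_pmap; apply/mapP; exists (Some c).
    by rewrite cardsE (leq_trans (card_size _)) // size_pmap count_size.
  have urich : rich f P m D u.
    rewrite -ls; case: {ps ls us A cA} (tval s) rs => [|z t] //= /andP[rz rt].
    by elim: t z rz rt => //= z' t IHt z _ /andP[]; exact: IHt.
  have := forallP urich (S :\: A); rewrite (fintype.subset_trans (finset.subsetDl _ _) SP) /=.
  rewrite (_ : (m <= _)%N) /=; last first.
    have := leq_trans (subset_leq_card (finset.subsetIr S A)) cA.
    by rewrite cardsD => SA; apply: leq_trans (leq_sub2l _ SA); lia.
  move/leq_trans; apply; rewrite /cdeg.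
  rewrite (leq_trans _ (leq_add (poor_nbrs u) (leqnn _))) //.
  apply: leq_trans (leq_card_setU _ _).
  apply/subset_leq_card/fintype.subsetP => w; rewrite inE => uw.
  have uwT : cadj f [set: 'I_q] u w by apply: cadj_sub uw; apply: finset.subsetT.
  rewrite !inE uwT /=; case: (boolP (rich f P m D w)) => //= rw; rewrite andbT.
  apply/existsP; exists [tuple of rcons s w] => /=.
  rewrite rcons_path ps ls last_rcons eqxx all_rcons rw rs /=.
  rewrite (cadj_sub _ uw) ?finset.subsetDl //=.
  rewrite /colours -cats1 pairmap_cat ls /= cats1 rcons_uniq -/(colours f x s) us andbT.
  move: uw; rewrite /cadj; case: (f [set u; w]) => [c|]; last by rewrite andbF.
  by rewrite !inE => /and3P[].
rewrite leqNgt; apply/negP => Wsmall.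
have UWsmall : (#|U :|: W| <= M)%N.
  apply: leq_trans room; apply: leq_trans (leq_card_setU _ _) _.
  rewrite cU mul2n -addnn leq_add //; first by rewrite leq_pexp2l // ltnW.
  by apply: leq_trans (ltnW Wsmall) _; rewrite leq_pexp2l.
have := sparse UWsmall; rewrite (card_pairs_sum
  (fun u w => [&& u \in U :|: W, w \in U :|: W & cadj f [set: 'I_q] u w])).
have big : (b ^ i * (D - K') <= \sum_u #|[set w | [&& u \in U :|: W, w \in U :|: W
     & cadj f [set: 'I_q] u w]]|)%N.
  rewrite -cU -sum_nat_const big_mkcond /=; apply: leq_sum => u _.
  case: ifP => // uU; rewrite leq_subLR (leq_trans (out _ uU)) // leq_add2l.
  apply/subset_leq_card/fintype.subsetP => w; rewrite !inE uU /= => /andP[-> ->].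
  by rewrite orbT.
have : (#|U :|: W| <= #|U| + #|W|)%N by exact: leq_card_setU.
rewrite cU; move: Wsmall; rewrite expnS => Wsmall sz sp.
have := leq_trans big sp.
have : (b ^ i * (2 * K * b.+1) <= b ^ i * (D - K'))%N by rewrite leq_mul2l; apply/orP; right; lia.
move: sz Wsmall; move: (#|U :|: W|) (#|W|) (b ^ i)%N => a c d sz Wsmall h1 h2.
have : (2 * K * a < 2 * K * (d + b * d))%N by rewrite ltn_mul2l; lia.
by nia.
Qed.

End ColouredGrowth.

(** * A deterministic rainbow colouring *)

(** With [P = P1 :|: P2] this is what the exploration reveals: a label in [P3] cannot be told from a
    non-edge. *)
Definition forget_label (q : nat) (P : {set 'I_q}) (t : option 'I_q) : option 'I_q :=
  if t is Some c then (if c \in P then Some c else None) else None.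

Lemma cadj_forget (V : finType) (q : nat) (P S : {set 'I_q}) (f : {set V} -> option 'I_q) u w :
  cadj (forget_label P \o f) S u w = cadj f (S :&: P) u w.
Proof.
rewrite /cadj /=; case: (f _) => [c|] //=; rewrite !inE.
by case: (c \in P); rewrite ?andbT ?andbF.
Qed.

Section Colourability.
Variables (V : finType) (q : nat) (f : {ffun {set V} -> option 'I_q}).
Variables (P1 P2 P3 : {set 'I_q}) (m D K K' k b M : nat).

Notation E := (label_graph f).
Notation P12 := (P1 :|: P2).
Notation g := (forget_label P12 \o f).
Notation richg := (rich g P12 m D).

Hypothesis no_isolated : forall x, exists w, adj E x w.
Hypothesis small_nonadjacent : forall x y, adj E x y ->
  (D <= degree E x)%N \/ (D <= degree E y)%N.
Hypothesis poor_nbrs : forall u,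
  (#|[set w | cadj f [set: 'I_q] u w && ~~ richg w]| <= K')%N.
Hypothesis sparse : forall U : {set V}, (#|U| <= M)%N ->
  (#|[set e : V * V | [&& e.1 \in U, e.2 \in U & cadj f [set: 'I_q] e.1 e.2]]|
     <= 2 * K * #|U|)%N.
Hypothesis few_colours : forall x (F : {set 'I_q}), (#|F| <= 3)%N -> (cdeg f F x + K' < D)%N.
Hypothesis join : forall x y (F : {set 'I_q}), (#|F| <= 4)%N ->
  (b ^ k <= #|reach g P12 m D (P1 :\: F) k x|)%N ->
  (b ^ k <= #|reach g P12 m D (P2 :\: F) k y|)%N ->
  exists u v, [/\ u \in reach g P12 m D (P1 :\: F) k x,
    v \in reach g P12 m D (P2 :\: F) k y & cadj f (P3 :\: F) u v].
Hypotheses (K_gt0 : (0 < K)%N) (b_gt0 : (0 < b)%N)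
  (branch : (2 * K * b.+1 + K' <= D)%N) (room : (2 * b ^ k <= M)%N)
  (D_gt1 : (1 < D)%N) (q_gt1 : (1 < q)%N) (k_gt0 : (0 < k)%N)
  (P1_large : (k + m + 4 <= #|P1|)%N) (P2_large : (k + m + 4 <= #|P2|)%N)
  (P12_disjoint : [disjoint P1 & P2]) (P3_disjoint : [disjoint P12 & P3]).

Lemma adj_label_graph u w : adj E u w = cadj f [set: 'I_q] u w.
Proof.
rewrite /adj inE /cadj inE cards2.
by case: (u != w) => //=; case: (f _) => // c; rewrite inE.
Qed.

Lemma degree_label_graph u : degree E u = cdeg f [set: 'I_q] u.
Proof. by rewrite /degree /cdeg; apply: eq_card => w; rewrite !inE adj_label_graph. Qed.

Lemma rich_degree u : richg u -> (D <= degree E u)%N.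
Proof.
move=> /forallP /(_ P12); rewrite subxx /= (_ : (m <= #|P12|)%N) /=; last first.
  by apply: leq_trans (subset_leq_card (finset.subsetUl P1 P2)); lia.
move/leq_trans; apply; rewrite degree_label_graph /cdeg.
apply/subset_leq_card/fintype.subsetP => w; rewrite !inE cadj_forget.
by apply: cadj_sub; apply: finset.subsetT.
Qed.

Definition small u := (degree E u < D)%N.

Definition first_edge u : {set V} := [set u; odflt u [pick w | adj E u w]].

(* Edges at a vertex of small degree are recoloured: pendant edges receive
   pairwise distinct colours, and at the other small vertices both colours 0
   and 1 occur.  All other edges keep their random colour. *)
Definition recolour (e : {set V}) : nat :=
  if [pick u | (u \in e) && small u] is Some u then
    if degree E u == 1%N then index u (enum [set x | degree E x == 1%N])
    else (e != first_edge u)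
  else if f e is Some c then c else 0%N.

Notation wlk := (walk E recolour).

Lemma recolour_lt e : (recolour e < maxn q (num_deg1 E))%N.
Proof.
rewrite /recolour; case: pickP => [u _|_].
  case: ifP => du; last by case: (_ != _); rewrite leq_max ?q_gt1 // ltnW.
  by rewrite leq_max /num_deg1 cardE index_mem mem_enum inE du orbT.
by case: (f e) => [c|]; rewrite leq_max ?ltn_ord // ltnW.
Qed.

(** Small vertices are pairwise non-adjacent, so [u] is the only small end of the edge and hence the
    vertex picked by [recolour]. *)
Lemma recolour_small u w : small u -> adj E u w ->
  ~~ small w /\ recolour [set u; w] =
    if degree E u == 1%N then index u (enum [set x | degree E x == 1%N])
    else ([set u; w] != first_edge u).
Proof.
move=> su uw; have sw : ~~ small w.
  rewrite /small -leqNgt; case: (small_nonadjacent uw) => // h.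
  by move: su; rewrite /small ltnNge h.
split=> //; rewrite /recolour; case: pickP => [z /andP[]|].
  by rewrite !inE => /orP[/eqP ->//|/eqP ->]; rewrite (negbTE sw).
by move=> /(_ u); rewrite !inE eqxx su.
Qed.

Lemma recolour_large u w c : ~~ small u -> ~~ small w -> f [set u; w] = Some c ->
  recolour [set u; w] = c.
Proof.
move=> su sw fc; rewrite /recolour fc; case: pickP => // z /andP[].
by rewrite !inE => /orP[] /eqP ->; rewrite ?(negbTE su) ?(negbTE sw).
Qed.

(** A pendant vertex has a single exit, coloured by its index; any other small vertex can choose
    between the colours 0 and 1, the boolean [a] being read as a number. *)
Lemma small_exit u : small u ->
  (degree E u == 1%N /\ exists w, [/\ ~~ small w, adj E u w &
     recolour [set u; w] = index u (enum [set x | degree E x == 1%N])]) \/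
  (forall a : bool, exists w, [/\ ~~ small w, adj E u w & recolour [set u; w] = a]).
Proof.
move=> su; have [w0 uw0] := no_isolated u.
case: (boolP (degree E u == 1%N)) => du.
  by left; split=> //; exists w0; have [sw] := recolour_small su uw0; rewrite du.
right; pose w1 := odflt u [pick w | adj E u w].
have uw1 : adj E u w1.
  by rewrite /w1; case: pickP => //= /(_ w0); rewrite uw0.
case.
  have [w uw ww1] : exists2 w, adj E u w & w != w1.
    apply: contrapT => h; move: du; rewrite /degree.
    suff -> : [set y | adj E u y] = [set w1] by rewrite cards1.
    apply/setP => y; rewrite !inE; apply/idP/eqP => [uy|-> //].
    by apply/eqP/negPn/negP => yw; apply: h; exists y.
  exists w; have [sw ->] := recolour_small su uw; split=> //.
  rewrite (negbTE du) (_ : (_ != _) = true) //.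
  apply/negP => /eqP eqe; have : w \in first_edge u by rewrite -eqe !inE eqxx orbT.
  rewrite !inE -/w1 (negbTE ww1) orbF => /eqP wu.
  by move: uw; rewrite wu adj_label_graph /cadj eqxx.
exists w1; have [sw ->] := recolour_small su uw1; split=> //.
by rewrite (negbTE du) /first_edge eqxx.
Qed.

(** Two pendant vertices have different indices, a small vertex with two exit colours takes one that
    differs from the other exit, and a vertex that is not small stays where it is. *)
Lemma two_exits x y : x != y -> exists x' y' cx cy, [/\ ~~ small x', ~~ small y',
  wlk x x' cx, wlk y y' cy & [/\ (size cx <= 1)%N, (size cy <= 1)%N & uniq (cx ++ cy)]].
Proof.
move=> xy; have [sx|lx] := boolP (small x); have [sy|ly] := boolP (small y).
- have [[dx [x' [sx' xx' ex]]]|fx] := small_exit sx.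
    have [[dy [y' [sy' yy' ey]]]|fy] := small_exit sy.
      exists x', y', [:: recolour [set x; x']], [:: recolour [set y; y']].
      split=> //; try exact: walk1; split=> //.
      rewrite /= inE andbT ex ey; apply: contra xy => /eqP exy.
      apply/eqP; have xin : x \in enum [set x | degree E x == 1%N] by rewrite mem_enum inE.
      by rewrite -(nth_index x xin) exy nth_index // mem_enum inE.
    (* The requested colour is 1 exactly when the other exit has colour 0, so the two differ. *)
    have [y' [sy' yy' ey]] := fy (recolour [set x; x'] == 0%N).
    exists x', y', [:: recolour [set x; x']], [:: recolour [set y; y']].
    split=> //; try exact: walk1; split=> //.
    by rewrite /= inE andbT ey; case: (recolour [set x; x']).
  have [[dy [y' [sy' yy' ey]]]|fy] := small_exit sy.
    have [x' [sx' xx' ex]] := fx (recolour [set y; y'] == 0%N).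
    exists x', y', [:: recolour [set x; x']], [:: recolour [set y; y']].
    split=> //; try exact: walk1; split=> //.
    by rewrite /= inE andbT ex; case: (recolour [set y; y']).
  have [x' [sx' xx' ex]] := fx false; have [y' [sy' yy' ey]] := fy true.
  exists x', y', [:: recolour [set x; x']], [:: recolour [set y; y']].
  by split=> //; try exact: walk1; split=> //; rewrite /= inE andbT ey ex.
- have [x' [c [sx' w cs]]] : exists x' c, [/\ ~~ small x', wlk x x' c & (size c <= 1)%N && uniq c].
    have [[_ [x' [sx' xx' _]]]|/(_ true) [x' [sx' xx' _]]] := small_exit sx;
      by exists x', [:: recolour [set x; x']]; split=> //; exact: walk1.
  case/andP: cs => cs uc; exists x', y, c, [::]; split=> //; first exact: walk_nil.
  by rewrite cats0.
- have [y' [c [sy' w cs]]] : exists y' c, [/\ ~~ small y', wlk y y' c & (size c <= 1)%N && uniq c].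
    have [[_ [y' [sy' yy' _]]]|/(_ true) [y' [sy' yy' _]]] := small_exit sy;
      by exists y', [:: recolour [set y; y']]; split=> //; exact: walk1.
  case/andP: cs => cs uc; exists x, y', [::], c; split=> //; exact: walk_nil.
- by exists x, y, [::], [::]; split=> //; exact: walk_nil.
Qed.

(** Of the at least [D] edges at [x], fewer than [D - K'] have a colour in [F] and at most [K'] lead
    to poor vertices. The bound 3 allows for two exit colours and the colour already taken at the
    other end. *)
Lemma rich_exit x (F : {set 'I_q}) : ~~ small x -> (#|F| <= 3)%N ->
  exists w c, [/\ richg w, c \notin F & wlk x w [:: val c]].
Proof.
move=> lx F3; have dx : (D <= degree E x)%N by move: lx; rewrite /small -leqNgt.
have [w] : exists w, [&& cadj f [set: 'I_q] x w, richg w & ~~ cadj f F x w].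
  apply: contrapT => h.
  have : (degree E x <= cdeg f F x + K')%N.
    rewrite degree_label_graph; apply: leq_trans (leq_add (leqnn _) (poor_nbrs x)).
    apply: leq_trans (leq_card_setU _ _).
    apply/subset_leq_card/fintype.subsetP => w; rewrite !inE => xw.
    case: (boolP (richg w)) => rw; last by rewrite xw orbT.
    rewrite andbF orbF; apply/negPn/negP => nw; apply: h; exists w.
    by rewrite xw rw nw.
  by rewrite leqNgt (leq_trans (few_colours x F3) dx).
case/and3P=> xw rw; move: (xw); rewrite /cadj => /andP[-> /=].
case fc: (f [set x; w]) => [c|] // _ cF; exists w, c; split=> //.
rewrite -(recolour_large lx _ fc); last by rewrite /small -leqNgt rich_degree.
by apply: walk1; rewrite adj_label_graph.
Qed.

(** Rich vertices have degree at least [D], so no edge of the explored walk has a small end and all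
    keep their random colours. *)
Lemma reach_walk (S : {set 'I_q}) i x y : ~~ small x -> y \in reach g P12 m D S i x ->
  exists cs : seq 'I_q, [/\ wlk x y (map val cs), uniq cs & {subset cs <= S}].
Proof.
move=> lx; rewrite inE => /existsP[s /and4P[ps rs /eqP <- us]] {y}.
suff [cs [wcs ecs sub]] : exists cs : seq 'I_q, [/\ wlk x (last x s) (map val cs),
    colours g x s = map Some cs & {subset cs <= S}].
  by exists cs; split=> //; move: us; rewrite ecs map_inj_uniq // => ? ? [].
case: s ps rs {us} => s /= _; elim: s x lx => [|z s IH] x lx /=.
  by move=> _ _; exists [::]; split=> //; exact: walk_nil.
case/andP=> xz ps /andP[rz rs].
have lz : ~~ small z by rewrite /small -leqNgt rich_degree.
have [cs [wcs ecs sub]] := IH z lz ps rs.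
have xzE : adj E x z.
  rewrite adj_label_graph; apply: cadj_sub (finset.subsetT _) _.
  by rewrite cadj_forget in xz; exact: xz.
move: xz; rewrite /cadj => /andP[_]; case gc: (g _) => [c|] // cS.
have fc : f [set x; z] = Some c.
  by move: gc => /=; case: (f _) => //= c'; case: ifP.
exists (c :: cs); split.
- rewrite /= -cat1s; apply: walk_cat wcs.
  by rewrite -(recolour_large lx lz fc); exact: walk1.
- by move: gc => /= gc; rewrite ecs gc.
- by move=> c'; rewrite inE => /orP[/eqP ->|/sub].
Qed.

(** The walk goes from [x] by [c1] to a rich [x2], inside [P1] to [u], by a colour of [P3] to [v],
    inside [P2] to a rich [y2], and by [c2] to [y]. The palettes are disjoint and the three middle
    stretches avoid [F], which holds [c1], [c2] and the forbidden colours. *)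
Lemma core_walk x y (F0 : seq nat) : ~~ small x -> ~~ small y -> (size F0 <= 2)%N ->
  exists cs, [/\ wlk x y cs, uniq cs & {in cs, forall c, c \notin F0}].
Proof.
(* Forbidden colours that are at least [q], as pendant edges may have, never occur on the core walk,
   so only those below [q] enter [F1]. *)
move=> lx ly F0s; pose F1 := [set c : 'I_q | val c \in F0].
have F1s : (#|F1| <= 2)%N.
  apply: leq_trans F0s; rewrite cardE -(size_map val) uniq_leq_size //.
    by rewrite map_inj_uniq ?enum_uniq //; exact: val_inj.
  by move=> c /mapP[c']; rewrite mem_enum inE => ? ->.
have [x2 [c1 [rx c1F wx]]] := rich_exit lx (leqW F1s).
have [|y2 [c2 [ry c2F wy]]] := @rich_exit y (c1 |: F1) ly.
  by rewrite cardsU1 (leq_add (leq_b1 _) F1s).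
pose F := c2 |: (c1 |: F1).
have F4 : (#|F| <= 4)%N.
  by rewrite /F !cardsU1 (leq_add (leq_b1 _) (leq_add (leq_b1 _) F1s)).
have grow (Q : {set 'I_q}) z : Q \subset P12 -> (k + m + 4 <= #|Q|)%N -> richg z ->
    (b ^ k <= #|reach g P12 m D (Q :\: F) k z|)%N.
  move=> QP Qs rz; apply: (@reach_growth _ _ g P12 m D K K' k b M) => //.
  - move=> u; apply: leq_trans (poor_nbrs u).
    apply/subset_leq_card/fintype.subsetP => w; rewrite !inE cadj_forget => /andP[uw ->].
    by rewrite (cadj_sub _ uw) // finset.subsetT.
  - move=> U Us; apply: leq_trans (sparse Us).
    apply/subset_leq_card/fintype.subsetP => e; rewrite !inE cadj_forget => /and3P[-> -> uw].
    by rewrite (cadj_sub _ uw) // finset.subsetT.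
  - exact: fintype.subset_trans (finset.subsetDl _ _) QP.
  - have := leq_trans (subset_leq_card (finset.subsetIr Q F)) F4.
    rewrite cardsD => QF; apply: leq_trans (leq_sub2l _ QF).
    by rewrite leq_subRL ?(leq_trans _ Qs) ?leq_addl // addnC.
have [u [v [ux vy uv]]] := join F4 (grow P1 _ (finset.subsetUl _ _) P1_large rx)
  (grow P2 _ (finset.subsetUr _ _) P2_large ry).
have nsmall z : richg z -> ~~ small z by move=> rz; rewrite /small -leqNgt rich_degree.
(* The end of a walk is known to be rich only if the walk is nonempty, hence [k_gt0]. *)
have reach_rich (Q : {set 'I_q}) z z' : z' \in reach g P12 m D Q k z -> richg z'.
  rewrite inE => /existsP[s /and4P[_ rs /eqP <- _]].
  have := size_tuple s; case: (tval s) rs => [|z1 t] /allP rt.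
    by move=> k0; move: k_gt0; rewrite -k0.
  by move=> _; apply: rt; rewrite /= mem_last.
have [cs1 [w1 u1 sub1]] := reach_walk (nsmall _ rx) ux.
have [cs2 [w2 u2 sub2]] := reach_walk (nsmall _ ry) vy.
have ru := reach_rich _ _ _ ux; have rv := reach_rich _ _ _ vy.
move: (uv); rewrite /cadj => /andP[_]; case fuv: (f _) => [c3|] // c3P.
have w3 : wlk u v [:: val c3].
  have <- : recolour [set u; v] = val c3.
    exact: recolour_large (nsmall _ ru) (nsmall _ rv) fuv.
  apply: walk1.
  by rewrite adj_label_graph; apply: cadj_sub (finset.subsetT _) uv.
exists (map val (c1 :: cs1 ++ c3 :: rev cs2 ++ [:: c2])); split.
- rewrite -cat1s map_cat; apply: walk_cat wx _.
  rewrite map_cat; apply: walk_cat w1 _; rewrite -cat1s map_cat; apply: walk_cat w3 _.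
  by rewrite map_cat map_rev; apply: walk_cat (walk_rev w2) (walk_rev wy).
- rewrite map_inj_uniq; last exact: val_inj.
  have inF c : c \in F = [|| c == c2, c == c1 | c \in F1] by rewrite !inE.
  have s1 c : c \in cs1 -> (c \in P1) && (c \notin F) by move=> /sub1; rewrite inE andbC.
  have s2 c : c \in cs2 -> (c \in P2) && (c \notin F) by move=> /sub2; rewrite inE andbC.
  have c12 : c1 != c2 by apply: contra c2F => /eqP ->; rewrite !inE eqxx.
  have /andP[c3P3 c3F] : (c3 \in P3) && (c3 \notin F) by move: c3P; rewrite inE andbC.
  have P3d c : c \in P12 -> c != c3.
    by move=> cP; apply: contraL c3P3 => /eqP <-; rewrite (disjointFr P3_disjoint).
  rewrite /= mem_cat inE mem_cat mem_rev !inE !negb_or.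
  apply/andP; split.
    apply/and4P; split=> //.
    + by apply/negP => /s1; rewrite inF eqxx orbT andbF.
    + by apply: contra c3F => /eqP <-; rewrite inF eqxx orbT.
    + by apply/negP => /s2; rewrite inF eqxx orbT andbF.
  rewrite cat_uniq u1 /= mem_cat mem_rev inE negb_or cat_uniq rev_uniq u2 /= mem_rev.
  rewrite !orbF !andbT has_cat /= orbF has_rev !negb_or.
  apply/andP; split; last first.
    rewrite -andbA; apply/and3P; split.
    + by apply/negP => /s2 /andP[cP _]; move: (P3d c3); rewrite inE cP orbT eqxx => /(_ isT).
    + by apply: contra c3F => /eqP ->; rewrite inF eqxx.
    + by apply/negP => /s2; rewrite inF eqxx andbF.
  apply/and3P; split.
  + by apply/negP => /s1 /andP[cP _]; move: (P3d c3); rewrite inE cP eqxx => /(_ isT).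
  + apply/hasPn => c /s2 /andP[cP2 _]; apply/negP => /s1 /andP[cP1 _].
    by move: cP2; rewrite (disjointFr P12_disjoint).
  + by apply/negP => /s1; rewrite inF eqxx andbF.
- move=> c /mapP[c' + ->]; have -> : (val c' \notin F0) = (c' \notin F1) by rewrite inE.
  have nF z : z \notin F -> z \notin F1 by apply: contra; rewrite !inE => ->; rewrite !orbT.
  rewrite inE mem_cat inE mem_cat mem_rev inE => /or4P[/eqP -> //|/sub1||].
  + by rewrite inE => /andP[/nF].
  + by move=> /eqP ->; move: c3P; rewrite inE => /andP[/nF].
  + case/orP => [/sub2|/eqP ->]; first by rewrite inE => /andP[/nF].
    by move: c2F; rewrite inE negb_or => /andP[].
Qed.

Lemma label_graph_rainbow : rainbow_colorable E (maxn q (num_deg1 E)).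
Proof.
exists recolour; split=> [e _|x y]; first exact: recolour_lt.
have [<-|xy] := eqVneq x y.
  by exists [::]; rewrite /rainbow_path /= eqxx.
have [x' [y' [cx [cy [lx ly wx wy [sx sy ucc]]]]]] := two_exits xy.
have [|cs [w u nin]] := @core_walk x' y' (cx ++ cy) lx ly; first by rewrite size_cat; lia.
apply: (walk_rainbow (walk_cat wx (walk_cat w (walk_rev wy)))).
move: ucc; rewrite !cat_uniq u rev_uniq /= => /and3P[-> ncc ->]; rewrite andbT /=.
rewrite has_cat negb_or has_rev ncc andbT.
apply/andP; split; apply/hasPn => c; first by move/nin; rewrite mem_cat negb_or => /andP[].
by rewrite mem_rev => cin /=; apply/negP => /nin; rewrite mem_cat cin orbT.
Qed.

End Colourability.

(** * First moment estimates *)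

Section FirstMoments.
Variables (R : realType) (n q : nat) (p : R).
Hypotheses (q_gt0 : (0 < q)%N) (p_ge0 : 0 <= p) (p_le1 : p <= 1).
Notation lw := (@label_weight R q p).
Notation V := 'I_n.
Implicit Types (f : {ffun {set V} -> option 'I_q}).

Let lw_ge0 := @label_weight_ge0 R q p p_ge0 p_le1.
Let lw_sum1 := @label_weight_sum1 R q p q_gt0.

Definition in_labels (S : {set 'I_q}) (t : option 'I_q) : bool :=
  if t is Some c then c \in S else false.

Lemma expect_labels (S : {set 'I_q}) (a : R) :
  \sum_t lw t * (if in_labels S t then a else 1) = 1 + (a - 1) * (p * (#|S|%:R / q%:R)).
Proof.
rewrite -[in RHS]sum_weight_in -[X in X + _]lw_sum1 mulr_sumr [X in _ + X]big_mkcond -big_split /=.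
apply: eq_bigr => t _; rewrite /in_labels; case: ifP => _; ring.
Qed.

Lemma expect_some : \sum_t lw t * (isSome t)%:R = p.
Proof.
by rewrite sum_option /= mulr0 add0r; under eq_bigr do rewrite mulr1; exact: sum_some_weight.
Qed.

Lemma expect_none : \sum_t lw t * (~~ isSome t)%:R = 1 - p.
Proof. by rewrite sum_option /= mulr1 big1 ?addr0 // => c _; rewrite mulr0. Qed.

Lemma prodr_ge1 (I : finType) (Q : pred I) (F : I -> R) :
  (forall i, Q i -> 1 <= F i) -> 1 <= \prod_(i | Q i) F i.
Proof.
move=> F1; apply: (big_ind (fun x => 1 <= x)) => // x y x1 y1.
by rewrite -[1]mulr1 ler_pM.
Qed.

Lemma edge_inj (x : V) : {in predC1 x &, injective (fun z => [set x; z])}.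
Proof.
move=> y z; rewrite !inE => yx zx e.
have : y \in [set x; z] by rewrite -e !inE eqxx orbT.
by rewrite !inE (negbTE yx) /= => /eqP.
Qed.

Lemma Pr_isolated :
  Pr lw (fun f => exists x : V, forall w, ~~ adj (label_graph f) x w) <=
    n%:R * (1 - p) ^+ n.-1.
Proof.
apply: le_trans (Pr_le lw_ge0 (B := fun f => exists2 x : V, xpredT x &
   forall w, ~~ adj (label_graph f) x w) _) _.
  by move=> f [x hx]; exists x.
apply: le_trans (Pr_exists lw_ge0 _ _) _.
have one x : Pr lw (fun f => forall w, ~~ adj (label_graph f) x w) <= (1 - p) ^+ n.-1.
  apply: le_trans (@Pr_prod_bound _ _ _ lw lw_ge0 lw_sum1 _ (fun w : V => w != x)
    (fun w => [set x; w]) (fun _ t => (~~ isSome t)%:R) 1 _ _ _ _ _) _ => //.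
  - by move=> y z yx zx; apply: edge_inj.
  - move=> f nx; rewrite mul1r big1 // => w wx.
    have := nx w; rewrite adj_label_graph /cadj eq_sym wx /=.
    by case: (f _) => // c; rewrite inE.
  - rewrite mul1r; under eq_bigr do rewrite expect_none.
    by rewrite prodr_const cardC1 card_ord.
apply: le_trans (ler_sum _ (fun x _ => one x)) _.
by rewrite sumr_const card_ord mulr_natl.
Qed.

(* Exponential moment bound for lower tails at all vertices of U simultaneously:
   the edges from U to the complement of W are pairwise distinct, hence independent. *)
Lemma Pr_low_degrees (U W : {set V}) (B : {set {set V}}) (S : V -> {set 'I_q})
    (s D : nat) (t : R) (A : {ffun {set V} -> option 'I_q} -> Prop) :
  U \subset W -> (forall e, e \in B -> e \subset W) -> 0 < t -> t <= 1 ->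
  (forall u, u \in U -> (s <= #|S u|)%N) -> (s <= q)%N ->
  (forall f, A f -> (forall e, e \in B -> f e) /\
     (forall u, u \in U -> (#|[set z | z \notin W & cadj f (S u) u z]| < D)%N)) ->
  Pr lw A <= p ^+ #|B| *
    (t^-1 ^+ D * (1 - (1 - t) * (p * (s%:R / q%:R))) ^+ #|~: W|) ^+ #|U|.
Proof.
move=> UW BW t0 t1 Ss sq HA.
(* An index is a required edge of [B], which lies inside [W], or a pair [(a, z)] leaving [W]; so
   different indices name different vertex sets. *)
pose Q (j : {set V} + V * V) := match j with inl e => e \in B
  | inr (a, z) => (a \in U) && (z \notin W) end.
pose phi (j : {set V} + V * V) := match j with inl e => e | inr (a, z) => [set a; z] end.
pose h (j : {set V} + V * V) (l : option 'I_q) : R := match j with inl e => (isSome l)%:R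
  | inr (a, z) => if in_labels (S a) l then t else 1 end.
have QP a z : inr (a, z) \in Q -> a \in U /\ z \notin W.
  by move=> aQ; apply/andP; exact: aQ.
have inj : {in Q &, injective phi}.
  move=> [e|[a z]] [e'|[a' z']] /=.
  - by move=> _ _ ->.
  - move=> eB /QP[a'U z'W] ee; have := fintype.subsetP (BW _ eB) z'.
    by rewrite ee !inE eqxx orbT => /(_ isT); rewrite (negbTE z'W).
  - move=> /QP[aU zW] eB ee; have := fintype.subsetP (BW _ eB) z.
    by rewrite -ee !inE eqxx orbT => /(_ isT); rewrite (negbTE zW).
  - move=> /QP[aU zW] /QP[a'U z'W] ee.
    have aW := fintype.subsetP UW _ aU; have a'W := fintype.subsetP UW _ a'U.
    have : a \in [set a'; z'] by rewrite -ee !inE eqxx.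
    have : z \in [set a'; z'] by rewrite -ee !inE eqxx orbT.
    rewrite !inE => /orP[/eqP e|/eqP ->]; first by rewrite e a'W in zW.
    by move=> /orP[/eqP ->|/eqP e] //; rewrite -e aW in z'W.
have split_inr (G : V * V -> R) : \prod_(i | Q (inr i)) G i =
    \prod_(a in U) \prod_(z | z \notin W) G (a, z).
  by rewrite pair_big; apply: eq_big => -[a z].
have tV : 1 <= t^-1 by rewrite invf_ge1.
apply: le_trans (@Pr_prod_bound _ _ _ lw lw_ge0 lw_sum1 _ Q phi h ((t^-1 ^+ D) ^+ #|U|) A
  inj _ _ _) _.
- by rewrite !exprn_ge0 // invr_ge0 ltW.
- by move=> [e|[a z]] l _ /=; [case: l | case: ifP => // _; exact: ltW].
- move=> f /HA[Bf Uf]; rewrite big_sumType split_inr [X in _ * (X * _)]big1 ?mul1r; last first.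
    by move=> e eB; rewrite /= Bf.
  rewrite -prodr_const -big_split /=; apply: prodr_ge1 => u uU.
  rewrite (bigID (fun z => in_labels (S u) (f [set u; z]))) /=.
  rewrite [X in _ * (_ * X)]big1 ?mulr1; last by move=> z /andP[_ /negbTE ->].
  rewrite (eq_bigr (fun=> t)); last by move=> z /andP[_ ->].
  rewrite prodr_const; set X := #|_|.
  (* There are [X] hits, each weighted by [t <= 1]; as [X <= D], the factor [t^-1 ^+ D] makes up for
     them. *)
  have XD : (X <= D)%N.
    apply: leq_trans (ltnW (Uf u uU)); rewrite -[X in (_ <= X)%N]cardsE.
    apply/subset_leq_card/fintype.subsetP => z; rewrite !inE => /andP[zW lz].
    rewrite zW /cadj -/(in_labels (S u) (f [set u; z])) lz andbT; apply: contraNneq zW => <-.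
    exact: fintype.subsetP UW _ uU.
  rewrite -(subnK XD) exprD -mulrA -exprMn mulVf ?gt_eqF // expr1n mulr1.
  by rewrite exprn_ege1.
- rewrite big_sumType split_inr /= (eq_bigr (fun=> p)); last by move=> e _; exact: expect_some.
  rewrite prodr_const mulrCA ler_wpM2l ?exprn_ge0 // exprMn ler_wpM2l ?exprn_ge0 ?invr_ge0 ?(ltW t0) //.
  rewrite -[leRHS]prodr_const; apply: ler_prod => u uU; rewrite prodr_ge0 /=; last first.
    move=> z _; apply: sumr_ge0 => l _; rewrite mulr_ge0 //.
    by case: ifP => // _; exact: ltW.
  rewrite (eq_bigl (mem (~: W))); last by move=> z; rewrite !inE.
  rewrite -[leRHS]prodr_const; apply: ler_prod => z _; rewrite expect_labels.
  have Sq : #|S u|%:R / q%:R <= 1 :> R.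
    rewrite ler_pdivrMr ?ltr0n // mul1r ler_nat -[leqRHS](card_ord q); exact: max_card.
  have S0 : 0 <= #|S u|%:R / q%:R :> R by rewrite divr_ge0.
  have sS : s%:R / q%:R <= #|S u|%:R / q%:R :> R.
    by rewrite ler_wpM2r ?invr_ge0 // ler_nat Ss.
  have pS : p * (s%:R / q%:R) <= p * (#|S u|%:R / q%:R) by rewrite ler_wpM2l.
  have pS1 : p * (#|S u|%:R / q%:R) <= 1 by rewrite mulr_ile1.
  have pS0 : 0 <= p * (#|S u|%:R / q%:R) by rewrite mulr_ge0.
  move: pS pS1 pS0; move: (p * (#|S u|%:R / q%:R)) (p * (s%:R / q%:R)) => x y yx x1 x0.
  by apply/andP; split; nra.
Qed.

(** Union bound over ordered pairs, with [U] and [W] both equal to the two ends, their edge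
    required, and the whole palette in the place of [S]. *)
Lemma Pr_small_adjacent (D : nat) (t : R) : 0 < t -> t <= 1 ->
  Pr lw (fun f => exists x y : V, [/\ adj (label_graph f) x y,
     (degree (label_graph f) x < D)%N & (degree (label_graph f) y < D)%N]) <=
    n%:R * n%:R * (p * (t^-1 ^+ D * (1 - (1 - t) * p) ^+ n.-2) ^+ 2).
Proof.
move=> t0 t1.
apply: le_trans (Pr_le lw_ge0 (B := fun f => exists2 e : V * V, xpredT e &
   [/\ adj (label_graph f) e.1 e.2, (degree (label_graph f) e.1 < D)%N &
       (degree (label_graph f) e.2 < D)%N]) _) _.
  by move=> f [x [y h]]; exists (x, y).
apply: le_trans (Pr_exists lw_ge0 _ _) _.
apply: le_trans (ler_sum _ (fun e _ => _ : _ <= p * (t^-1 ^+ D * (1 - (1 - t) * p) ^+ n.-2) ^+ 2)) _;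
  last by rewrite sumr_const card_prod card_ord -[leLHS]mulr_natl natrM.
move=> [x y] /=.
have [->|xy] := eqVneq x y.
  rewrite /Pr big_pred0; last first.
    by move=> f; apply/asboolP => -[]; rewrite adj_label_graph /cadj eqxx.
  have : (1 - t) * p <= 1 by rewrite mulr_ile1 ?subr_ge0 // lerBlDr lerDl ltW.
  by move=> tp; rewrite mulr_ge0 // exprn_ge0 // mulr_ge0 ?exprn_ge0 ?invr_ge0 ?(ltW t0) // subr_ge0.
have xyP : [set x; y] \subset [set x; y] by [].
have := @Pr_low_degrees [set x; y] [set x; y] [set [set x; y]]
  (fun=> [set: 'I_q]) q D t (fun f => [/\ adj (label_graph f) x y,
   (degree (label_graph f) x < D)%N & (degree (label_graph f) y < D)%N]) xyP.
rewrite cards1 expr1 cards2 xy divff ?mulr1 ?pnatr_eq0 -?lt0n //.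
rewrite (_ : #|~: [set x; y]| = n.-2); last first.
  by rewrite cardsCs finset.setCK cards2 card_ord xy subn2.
move=> low _; apply: low => //.
- by move=> e; rewrite inE => /eqP ->.
- by move=> u _; rewrite cardsT card_ord.
move=> f [axy dx dy]; split.
  move=> e; rewrite inE => /eqP ->.
  by move: axy; rewrite /adj inE => /andP[].
move=> u uxy; apply: (@leq_ltn_trans (degree (label_graph f) u)); last first.
  by move: uxy; rewrite !inE => /orP[] /eqP ->.
apply/subset_leq_card/fintype.subsetP => z; rewrite !inE => /andP[_].
by rewrite adj_label_graph.
Qed.

(** Union bound over the vertex [v], a set [U] of [r] poor neighbours and a failing palette for each
    of them. The edges leaving [v |: U] from its members in [U] are independent, so each neighbour
    contributes its own factor. *)
Lemma Pr_poor_neighbours (P : {set 'I_q}) (m D r : nat) (t : R) : 0 < t -> t <= 1 -> (m <= q)%N ->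
  Pr lw (fun f => exists v : V, (r <= #|[set w | cadj f [set: 'I_q] v w &&
       ~~ rich (forget_label P \o f) P m D w]|)%N) <=
    n%:R * (n%:R * 2 ^+ q * p *
      (t^-1 ^+ D * (1 - (1 - t) * (p * (m%:R / q%:R))) ^+ (n - r.+1))) ^+ r.
Proof.
move=> t0 t1 mq.
set y := t^-1 ^+ D * _.
pose PU (U : {set V}) v := (#|U| == r) && (v \notin U).
pose ev v (U : {set V}) (S : {ffun V -> {set 'I_q}}) f :=
  (forall w, w \in U -> f [set v; w]) /\
  (forall w, w \in U -> (#|[set z | z \notin v |: U & cadj f (S w) w z]| < D)%N).
pose U_of (s : r.-tuple V) := [set x in s].
(* Palettes are empty off [U], so at most [(2 ^ q) ^ r] choices are counted instead of
   [(2 ^ q) ^ n]. *)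
pose palettes (U : {set V}) (S : {ffun V -> {set 'I_q}}) :=
  (S \in pffun_on (@finset.set0 'I_q) (mem U) predT) && [forall w in U, (m <= #|S w|)%N].
apply: le_trans (Pr_le lw_ge0 (B := fun f => exists2 e : V * (r.-tuple V),
   PU (U_of e.2) e.1 & exists2 S, palettes (U_of e.2) S & ev e.1 (U_of e.2) S f) _) _.
  move=> f [v rv]; have [U UN Ur] := subset_of_card rv.
  have [s sU] : exists s : r.-tuple V, U = [set x in s].
    have sz : size (enum U) == r by rewrite -cardE Ur.
    by exists (Tuple sz); apply/setP => x; rewrite inE /= mem_enum.
  exists (v, s); rewrite /= /U_of -sU.
    rewrite /PU Ur eqxx /=; apply/negP => /(fintype.subsetP UN).
    by rewrite inE /cadj eqxx.
  have pickS w : {S : {set 'I_q} | w \in U -> [/\ S \subset P, (m <= #|S|)%N &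
      (cdeg (forget_label P \o f) S w < D)%N]}.
    case: (boolP (w \in U)) => wU; last by exists finset.set0.
    apply: cid; move/(fintype.subsetP UN): wU; rewrite inE => /andP[_].
    rewrite /rich negb_forall => /existsP[S]; rewrite negb_imply => /andP[/andP[SP Sm] SD].
    by exists S => _; rewrite SP Sm ltnNge.
  pose S := [ffun w => if w \in U then sval (pickS w) else finset.set0].
  have SE w : w \in U -> S w = sval (pickS w) by move=> wU; rewrite ffunE ifT.
  exists S.
    apply/andP; split.
      apply/pffun_onP; split=> //; apply/fintype.subsetP => w.
      by rewrite !inE ffunE; case: ifP => //; rewrite eqxx.
    by apply/forall_inP => w wU; rewrite SE //; have [] := svalP (pickS w) wU.
  split=> w wU.
    by move/(fintype.subsetP UN): wU; rewrite inE /cadj => /andP[/andP[_]]; case: (f _).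
  have [SP _] := svalP (pickS w) wU; apply: leq_ltn_trans.
  apply/subset_leq_card/fintype.subsetP => z; rewrite !inE SE // => /andP[_].
  by rewrite cadj_forget; congr cadj; apply/esym/finset.setIidPl.
apply: le_trans (Pr_exists lw_ge0 _ _) _.
have y0 : 0 <= y.
  have mq1 : m%:R / q%:R <= 1 :> R by rewrite ler_pdivrMr ?ltr0n // mul1r ler_nat.
  have : (1 - t) * (p * (m%:R / q%:R)) <= 1.
    have pm0 : 0 <= p * (m%:R / q%:R) by rewrite mulr_ge0 ?divr_ge0.
    have pm1 : p * (m%:R / q%:R) <= 1 by rewrite mulr_ile1 ?divr_ge0.
    by move: pm0 pm1; move: (p * _) => x x0 x1; nra.
  by move=> tp; rewrite mulr_ge0 // ?exprn_ge0 ?invr_ge0 ?(ltW t0) // subr_ge0.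
apply: le_trans (_ : _ <= \sum_(e : V * (r.-tuple V)) (2 ^+ q * p * y) ^+ r) _; last first.
  rewrite sumr_const card_prod card_tuple card_ord -[leLHS]mulr_natl natrM -mulrA.
  by rewrite natrX -exprMn !mulrA.
rewrite big_mkcond /=; apply: ler_sum => -[v s] _ /=.
case: ifP => [|_]; last first.
  by apply: exprn_ge0; apply: mulr_ge0 y0; apply: mulr_ge0 => //; apply: exprn_ge0.
set U := U_of s; case/andP=> /eqP Ur vU.
apply: le_trans (Pr_exists lw_ge0 _ _) _.
have one S : palettes U S -> Pr lw (ev v U S) <= (p * y) ^+ r.
  case/andP=> _ /forall_inP mS.
  have := @Pr_low_degrees U (v |: U) [set [set v; w] | w in U]
    S m D t (ev v U S) (finset.subsetUr _ _).
  rewrite card_in_imset; last first.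
    by move=> w w' wU w'U; apply: edge_inj; rewrite inE; apply: contraNneq vU => <-.
  rewrite Ur cardsCs finset.setCK cardsU1 vU Ur card_ord => low; rewrite exprMn; apply: low => //.
    move=> e /imsetP[w wU ->]; apply/fintype.subsetP => z.
    by case/set2P => ->; rewrite in_setU1 ?eqxx ?wU ?orbT.
  by move=> f [ev1 ev2]; split=> // e /imsetP[w wU ->]; exact: ev1.
apply: le_trans (ler_sum _ one) _.
have py0 : 0 <= p * y by apply: mulr_ge0.
rewrite sumr_const -[leLHS]mulr_natl -[X in _ <= X ^+ _]mulrA [leRHS]exprMn ler_wpM2r ?exprn_ge0 //.
rewrite -!natrX ler_nat -[in leqRHS]Ur.
have <- : #|{: {set 'I_q}}| = (2 ^ q)%N.
  by rewrite -cardsT -powersetT card_powerset cardsT card_ord.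
rewrite -(card_pffun_on (@finset.set0 'I_q)).
by apply/subset_leq_card/fintype.subsetP => S /andP[].
Qed.

Lemma sum_exprn_card (T : finType) (y : R) : \sum_(U : {set T}) y ^+ #|U| = (1 + y) ^+ #|T|.
Proof.
have -> : (1 + y) ^+ #|T| = \prod_(i : T) (y + 1) by rewrite prodr_const addrC.
rewrite bigA_distr; apply: eq_bigr => U _.
by rewrite -big_mkcond /= prodr_const.
Qed.

(** A Chernoff bound with weight [T] per edge gives at most [y ^+ #|U|] for each nonempty [U], since
    [U] has at most [M * #|U|] pairs; the binomial theorem sums these terms over all [U]. *)
Lemma Pr_dense_subset (K M : nat) (T : R) : 1 <= T ->
  Pr lw (fun f => exists2 U : {set V}, (#|U| <= M)%N & (2 * K * #|U| <
    #|[set e : V * V | [&& e.1 \in U, e.2 \in U & cadj f [set: 'I_q] e.1 e.2]]|)%N) <=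
    (1 + T^-1 ^+ K * expR (T * p * M%:R)) ^+ n - 1.
Proof.
move=> T1; set y := _ * expR _.
have T0 : 0 < T by apply: lt_le_trans T1.
have y0 : 0 <= y by rewrite mulr_ge0 ?expR_ge0 // exprn_ge0 // invr_ge0 ltW.
(* Each edge is counted once, smaller end first, so that the labels looked at are distinct
   coordinates; the ordered count is at most twice this one. *)
pose up (U : {set V}) f :=
  #|[set e : V * V | [&& e.1 \in U, e.2 \in U, (e.1 < e.2)%N & f [set e.1; e.2]]]|.
apply: le_trans (Pr_le lw_ge0 (B := fun f => exists2 U : {set V},
   (#|U| <= M)%N && (U != finset.set0) & (K * #|U| <= up U f)%N) _) _.
  move=> f [U UM Ud]; exists U.
    rewrite UM /=; apply/eqP => U0; move: Ud; rewrite ltnNge => /negP; apply.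
    by apply: (@leq_trans 0%N) => //; rewrite leqn0 cards_eq0; apply/eqP/setP => e; rewrite !inE U0 inE.
  pose dn := #|[set e : V * V | [&& e.1 \in U, e.2 \in U, (e.2 < e.1)%N & f [set e.1; e.2]]]|.
  have swap_inj : injective (fun e : V * V => (e.2, e.1)) by move=> [a b] [c d] [-> ->].
  have updn : up U f = dn.
    rewrite /up /dn -[LHS](card_imset _ swap_inj); apply: eq_card => -[a b].
    apply/imsetP/idP => [[[c d]]|].
      by rewrite !inE /= => /and4P[cU dU cd fcd] [-> ->]; rewrite cU dU cd finset.setUC fcd.
    rewrite inE /= => /and4P[cU dU cd fcd]; exists (b, a) => //.
    by rewrite inE /= cU dU cd finset.setUC fcd.
  have : (#|[set e : V * V | [&& e.1 \in U, e.2 \in U & cadj f [set: 'I_q] e.1 e.2]]|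
     <= up U f + dn)%N.
    apply: leq_trans (leq_card_setU _ _); apply/subset_leq_card/fintype.subsetP => -[a b].
    rewrite !inE /= => /and3P[-> -> /andP[ab]] /=.
    case: (f _) => [c|] // _; rewrite !andbT -neq_ltn; exact: ab.
  by rewrite -updn addnn -mul2n => /(leq_trans Ud); rewrite -mulnA ltn_pmul2l // => /ltnW.
apply: le_trans (Pr_exists lw_ge0 _ _) _.
have -> : (1 + y) ^+ n - 1 = \sum_(U : {set V} | U != finset.set0) y ^+ #|U|.
  rewrite -{1}[n]card_ord -sum_exprn_card (bigD1 (@finset.set0 V)) //= cards0 expr0.
  by rewrite addrAC subrr add0r.
rewrite big_mkcond [leRHS]big_mkcond /=; apply: ler_sum => U _.
case: (U != _); rewrite ?andbF // andbT; case: ifP => [UM|_]; last exact: exprn_ge0.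
pose Q (e : V * V) := [&& e.1 \in U, e.2 \in U & (e.1 < e.2)%N].
have inj : {in Q &, injective (fun e : V * V => [set e.1; e.2])}.
  move=> [a b] [c d] /and3P[/= _ _ ab] /and3P[/= _ _ cd] e.
  have : a \in [set c; d] by rewrite -e !inE eqxx.
  have : b \in [set c; d] by rewrite -e !inE eqxx orbT.
  have : c \in [set a; b] by rewrite e !inE eqxx.
  rewrite !inE => /orP[] /eqP ca /orP[] /eqP bc /orP[] /eqP ad; subst=> //;
    by rewrite ?ltnn // in ab cd *; have := ltn_trans ab cd; rewrite ltnn.
apply: le_trans (@Pr_prod_bound _ _ _ lw lw_ge0 lw_sum1 _ Q _
  (fun _ t => if in_labels [set: 'I_q] t then T else 1) (T^-1 ^+ (K * #|U|)) _ inj _ _ _) _.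
- by rewrite exprn_ge0 // invr_ge0 ltW.
- by move=> j t _; case: ifP => // _; exact: ltW.
- move=> f Uf; rewrite (bigID (fun e : V * V => f [set e.1; e.2])) /=.
  rewrite [X in _ * (_ * X)]big1 ?mulr1; last first.
    by move=> e /andP[_]; case: (f _).
  rewrite (eq_bigr (fun=> T)); last by move=> e /andP[_]; case: (f _) => //= c _; rewrite inE.
  rewrite prodr_const; set X := #|_|.
  have <- : up U f = X.
    apply: eq_card => e; transitivity (Q e && f [set e.1; e.2]) => //.
    by rewrite inE /Q -!andbA.
  rewrite -(subnK Uf) addnC exprD mulrA -exprMn mulVf ?gt_eqF // expr1n mul1r.
  by rewrite exprn_ege1.
under eq_bigr do rewrite expect_labels cardsT card_ord divff ?pnatr_eq0 -?lt0n // mulr1.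
rewrite prodr_const exprMn -exprM; apply: ler_wpM2l.
  by rewrite exprn_ge0 // invr_ge0 ltW.
have base : 1 + (T - 1) * p <= expR (T * p).
  by apply: le_trans (expR_ge1Dx _); rewrite lerD2l ler_wpM2r // lerBlDr lerDl.
have base0 : 0 <= 1 + (T - 1) * p by rewrite addr_ge0 ?mulr_ge0 ?subr_ge0.
apply: (@le_trans _ _ (expR (T * p) ^+ (M * #|U|))); last first.
  by rewrite exprM -expRM_natl mulrC.
apply: (@le_trans _ _ (expR (T * p) ^+ #|Q|)); first by rewrite lerXn2r // nnegrE expR_ge0.
rewrite ler_weXn2l //; first by rewrite -[leLHS]expR0 ler_expR mulr_ge0 // ltW.
apply: (@leq_trans #|finset.setX U U|); last by rewrite cardsX leq_mul2r UM orbT.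
by apply/subset_leq_card/fintype.subsetP => e /and3P[eU eU' _]; rewrite inE eU.
Qed.

(** A Chernoff upper tail for the edges at [x] with colour in [F]. The union over [F] costs [2 ^ q],
    which is [n^o(1)] for [q] of order [L]. *)
Lemma Pr_few_colours (h D : nat) (T : R) : 1 <= T ->
  Pr lw (fun f => exists (x : V) (F : {set 'I_q}), (#|F| <= h)%N /\ (D <= cdeg f F x)%N) <=
    n%:R * 2 ^+ q * (T^-1 ^+ D * expR (T * (p * (h%:R / q%:R)) * n%:R)).
Proof.
move=> T1; set y := _ * expR _.
have T0 : 0 < T by apply: lt_le_trans T1.
have y0 : 0 <= y by rewrite mulr_ge0 ?expR_ge0 // exprn_ge0 // invr_ge0 ltW.
apply: le_trans (Pr_le lw_ge0 (B := fun f => exists2 e : V * {set 'I_q}, (#|e.2| <= h)%N &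
  (D <= cdeg f e.2 e.1)%N) _) _.
  by move=> f [x [F [hF DF]]]; exists (x, F).
apply: le_trans (Pr_exists lw_ge0 _ _) _.
apply: (@le_trans _ _ (\sum_(e : V * {set 'I_q}) y)); last first.
  rewrite sumr_const card_prod card_ord -[leLHS]mulr_natl natrM.
  by rewrite -cardsT -powersetT card_powerset cardsT card_ord natrX.
rewrite big_mkcond /=; apply: ler_sum => -[x F] _ /=; case: ifP => // hF.
apply: le_trans (@Pr_prod_bound _ _ _ lw lw_ge0 lw_sum1 _ (fun w : V => w != x)
    (fun w => [set x; w]) (fun _ t => if in_labels F t then T else 1) (T^-1 ^+ D) _ _ _ _ _) _.
- by move=> a b ax bx; apply: edge_inj.
- by rewrite exprn_ge0 // invr_ge0 ltW.
- by move=> j t _; case: ifP => // _; exact: ltW.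
- move=> f DF; rewrite (bigID (fun w => in_labels F (f [set x; w]))) /=.
  rewrite [X in _ * (_ * X)]big1 ?mulr1; last by move=> z /andP[_ /negbTE ->].
  rewrite (eq_bigr (fun=> T)); last by move=> z /andP[_ ->].
  rewrite prodr_const; set X := #|_|.
  have <- : cdeg f F x = X.
    by rewrite /cdeg -[X in _ = X]cardsE; apply: eq_card => e; rewrite !inE /cadj eq_sym.
  rewrite -(subnK DF) addnC exprD mulrA -exprMn mulVf ?gt_eqF // expr1n mul1r.
  by rewrite exprn_ege1.
under eq_bigr do rewrite expect_labels.
rewrite prodr_const; apply: ler_wpM2l; first by rewrite exprn_ge0 // invr_ge0 ltW.
have Fh : p * (#|F|%:R / q%:R) <= p * (h%:R / q%:R).
  by rewrite ler_wpM2l // ler_wpM2r ?invr_ge0 // ler_nat.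
have F0 : 0 <= p * (#|F|%:R / q%:R) by rewrite mulr_ge0 ?divr_ge0.
have base : 1 + (T - 1) * (p * (#|F|%:R / q%:R)) <= expR (T * (p * (h%:R / q%:R))).
  apply: le_trans (expR_ge1Dx _); rewrite lerD2l.
  by move: Fh F0; move: (p * _) (p * _) => a b ab b0; nra.
have base0 : 0 <= 1 + (T - 1) * (p * (#|F|%:R / q%:R)) by rewrite addr_ge0 ?mulr_ge0 ?subr_ge0.
rewrite [X in _ <= expR X]mulrC expRM_natl.
apply: (@le_trans _ _ (expR (T * (p * (h%:R / q%:R))) ^+ #|fun w : V => w != x|)).
  by rewrite lerXn2r // nnegrE expR_ge0.
rewrite ler_weXn2l //; first by rewrite -[leLHS]expR0 ler_expR mulr_ge0 ?mulr_ge0 ?divr_ge0 // ltW.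
by rewrite -[leqRHS](card_ord n) max_card.
Qed.

(** With [j] inner vertices there are at most [n ^ j] candidate paths, and the [j.+1] edges of each
    are distinct because its vertices are. *)
Lemma Pr_short_path (r : nat) (x y : V) : x != y ->
  Pr lw (fun f => exists s, [/\ path (adj (label_graph f)) x s, uniq (x :: s),
     last x s = y & (size s <= r)%N]) <= \sum_(j < r) n%:R ^+ j * p ^+ j.+1.
Proof.
move=> xy.
apply: le_trans (Pr_le lw_ge0 (B := fun f => exists2 j : 'I_r, xpredT j &
  exists2 s : j.-tuple V, uniq (x :: rcons s y) & path (adj (label_graph f)) x (rcons s y)) _) _.
  move=> f [s [ps us ls sr]]; case/lastP: s ps us ls sr => [|s z] ps us.
    by move=> /= e; rewrite e eqxx in xy.
  rewrite last_rcons size_rcons => zy sr; rewrite {z}zy in ps us.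
  by exists (Ordinal sr) => //; exists (in_tuple s).
apply: le_trans (Pr_exists lw_ge0 _ _) _; apply: ler_sum => j _.
apply: le_trans (Pr_exists lw_ge0 _ _) _.
apply: (@le_trans _ _ (\sum_(s : j.-tuple V) p ^+ j.+1)); last first.
  by rewrite sumr_const card_tuple card_ord -[leLHS]mulr_natl natrX.
rewrite big_mkcond /=; apply: ler_sum => s _; case: ifP => us; last exact: exprn_ge0.
pose es := pairmap (fun u v => [set u; v]) x (rcons s y).
have szes : size es = j.+1 by rewrite size_pairmap size_rcons size_tuple.
apply: le_trans (@Pr_prod_bound _ _ _ lw lw_ge0 lw_sum1 _ xpredT
    (fun i : 'I_j.+1 => nth finset.set0 es i) (fun _ t => (isSome t)%:R) 1 _ _ _ _ _) _ => //.
- move=> a b _ _ /eqP; rewrite nth_uniq ?szes ?ltn_ord // => [/eqP/val_inj //|].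
  exact: uniq_pairmap_edge.
- move=> f ps; rewrite mul1r big1 // => i _.
  have : nth finset.set0 es i \in label_graph f.
    have : (i < size (rcons s y))%N by rewrite size_rcons size_tuple.
    move=> isz; rewrite (nth_pairmap x) //.
    by move/(pathP x): ps => /(_ i isz).
  by rewrite inE => /andP[_ ->].
under eq_bigr do rewrite expect_some.
by rewrite mul1r prodr_const card_ord.
Qed.

(** For fixed [x], [y], [F] the labels in [P1 :|: P2] determine both reach sets. Among the [N * N]
    ordered pairs between [N] vertices of each, at most [N] are diagonal and, by sparsity, at most
    [4 * K * N] have a revealed label. So at least [c] unordered pairs are hidden, and each of them
    misses [P3 :\: F] with conditional probability at most [1 - p * (m%:R / q%:R)]. *)
Lemma Pr_no_join (P1 P2 P3 : {set 'I_q}) (m D K k N M c : nat) :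
  [disjoint P1 :|: P2 & P3] -> (m + 4 <= #|P3|)%N -> (2 * N <= M)%N ->
  (2 * c + N + 4 * K * N <= N * N)%N ->
  Pr lw (fun f =>
    (forall U : {set V}, (#|U| <= M)%N ->
      (#|[set e : V * V | [&& e.1 \in U, e.2 \in U & cadj f [set: 'I_q] e.1 e.2]]|
        <= 2 * K * #|U|)%N) /\
    exists (x y : V) (F : {set 'I_q}),
      let g := forget_label (P1 :|: P2) \o f in
      let A := reach g (P1 :|: P2) m D (P1 :\: F) k x in
      let B := reach g (P1 :|: P2) m D (P2 :\: F) k y in
      [/\ (#|F| <= 4)%N, (N <= #|A|)%N, (N <= #|B|)%N &
        forall u v, u \in A -> v \in B -> ~~ cadj f (P3 :\: F) u v]) <=
    n%:R * n%:R * 2 ^+ q * (1 - p * (m%:R / q%:R)) ^+ c.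
Proof.
move=> dis P3m NM cN; set y := (1 - _) ^+ c.
have mq : (m <= q)%N.
  rewrite -[leqRHS](card_ord q); apply: leq_trans (max_card (mem P3)).
  by apply: leq_trans P3m; rewrite leq_addr.
have mq1 : m%:R / q%:R <= 1 :> R by rewrite ler_pdivrMr ?ltr0n // mul1r ler_nat.
have pm1 : p * (m%:R / q%:R) <= 1 by rewrite mulr_ile1 ?divr_ge0.
have y0 : 0 <= y by rewrite exprn_ge0 // subr_ge0.
pose RA (h : {set V} -> option 'I_q) (F : {set 'I_q}) x := reach h (P1 :|: P2) m D (P1 :\: F) k x.
pose RB (h : {set V} -> option 'I_q) (F : {set 'I_q}) x := reach h (P1 :|: P2) m D (P2 :\: F) k x.
pose ev f (e : V * V * {set 'I_q}) := [/\
    forall U : {set V}, (#|U| <= M)%N ->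
      (#|[set e : V * V | [&& e.1 \in U, e.2 \in U & cadj f [set: 'I_q] e.1 e.2]]|
        <= 2 * K * #|U|)%N,
    (#|e.2| <= 4)%N, (N <= #|RA (forget_label (P1 :|: P2) \o f) e.2 e.1.1|)%N,
    (N <= #|RB (forget_label (P1 :|: P2) \o f) e.2 e.1.2|)%N &
    forall u v, u \in RA (forget_label (P1 :|: P2) \o f) e.2 e.1.1 ->
      v \in RB (forget_label (P1 :|: P2) \o f) e.2 e.1.2 -> ~~ cadj f (P3 :\: e.2) u v].
apply: le_trans (Pr_le lw_ge0 (B := fun f => exists2 e, xpredT e & ev f e) _) _.
  by move=> f [sp [x [z [F [F4 NA NB nj]]]]]; exists ((x, z), F).
apply: le_trans (Pr_exists lw_ge0 _ _) _.
apply: (@le_trans _ _ (\sum_(e : V * V * {set 'I_q}) y)); last first.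
  rewrite sumr_const !card_prod card_ord -[leLHS]mulr_natl !natrM.
  by rewrite -cardsT -powersetT card_powerset cardsT card_ord natrX.
apply: ler_sum => -[[x z] F] _.
have [F4|F4] := leqP #|F| 4; last first.
  rewrite /Pr big_pred0 // => f; apply/asboolP => -[_ /=].
  by rewrite leqNgt F4.
(* The hidden pairs between the two reach sets; this set depends on the revealed labels only, as the
   conditional bound requires. *)
pose XX (h : {ffun {set V} -> option 'I_q}) : {set {set V}} := [set e | (h e == None) &&
  [exists u in RA h F x, exists v in RB h F z, (u != v) && (e == [set u; v])]].
pose B t := in_labels (P3 :\: F) t.
have sB : \sum_(t | B t) lw t = p * (#|P3 :\: F|%:R / q%:R) by exact: sum_weight_in.
have P3F : (m <= #|P3 :\: F|)%N.
  rewrite cardsD leq_subRL; last by rewrite subset_leq_card // finset.subsetIl.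
  apply: leq_trans P3m; rewrite addnC leq_add2l.
  by apply: leq_trans F4; rewrite subset_leq_card // finset.subsetIr.
have s1 : 0 <= 1 - \sum_(t | B t) lw t.
  rewrite sB subr_ge0 mulr_ile1 ?divr_ge0 // ler_pdivrMr ?ltr0n // mul1r ler_nat.
  by rewrite -[leqRHS](card_ord q) max_card.
have sm : 1 - \sum_(t | B t) lw t <= 1 - p * (m%:R / q%:R).
  by rewrite sB lerD2l lerN2 ler_wpM2l // ler_wpM2r ?invr_ge0 // ler_nat.
apply: (@Pr_conditional _ _ _ lw lw_ge0 lw_sum1 _ (forget_label (P1 :|: P2)) None B XX) => //.
  case=> //= c' /finset.setDP[c'P3 _].
  by rewrite (disjointFl dis).
move=> f [sp /= _ NA NB nj] /=; set h := finfun _.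
have hE : h = forget_label (P1 :|: P2) \o f :> (_ -> _).
  by apply/funext => e; rewrite ffunE.
rewrite -hE in NA NB nj; split.
- move=> e; rewrite inE => /andP[_ /exists_inP[u uA /exists_inP[v vB /andP[uv /eqP ->]]]].
  by have := nj u v uA vB; rewrite /cadj uv.
- by move=> e; rewrite inE => /andP[/eqP].
have [A AR AN] := subset_of_card NA; have [B' BR BN] := subset_of_card NB.
pose Z := [set e : V * V | [&& e.1 \in A, e.2 \in B', e.1 != e.2 & h [set e.1; e.2] == None]].
have ZX : (#|Z| <= 2 * #|XX h|)%N.
  (* A two-element set comes from at most two ordered pairs, told apart by the order of their
     ends. *)
  pose phi (e : V * V) := ([set e.1; e.2], (e.1 < e.2)%N).
  have inj : {in Z &, injective phi}.
    move=> [a b] [c1 d]; rewrite !inE /= => /and4P[_ _ ab _] /and4P[_ _ cd _] [e lt].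
    have : a \in [set c1; d] by rewrite -e !inE eqxx.
    have : b \in [set c1; d] by rewrite -e !inE eqxx orbT.
    rewrite !inE => /orP[] /eqP bb /orP[] /eqP aa; subst=> //; rewrite ?eqxx // in ab cd *.
    by move: lt ab; rewrite neq_ltn; case: ltngtP.
  rewrite -(card_in_imset inj) mulnC -card_bool -cardsT -cardsX.
  apply/subset_leq_card/fintype.subsetP => e /imsetP[[a b] abZ ->].
  move: abZ; rewrite !inE /= => /and4P[aA bB ab hab]; rewrite andbT hab /=.
  apply/exists_inP; exists a; first exact: (fintype.subsetP AR).
  by apply/exists_inP; exists b; [exact: (fintype.subsetP BR) | rewrite ab eqxx].
have big : (N * N <= #|Z| + N + 4 * K * N)%N.
  have Us : (#|A :|: B'| <= 2 * N)%N.
    by apply: leq_trans (leq_card_setU _ _) _; rewrite AN BN mul2n addnn.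
  have := sp _ (leq_trans Us NM); set Y := finset _ => Ys.
  apply: (@leq_trans (#|Z| + N + #|Y|)); last first.
    rewrite leq_add2l; apply: leq_trans Ys _.
    rewrite (_ : 4 * K * N = 2 * K * (2 * N))%N ?leq_mul2l ?Us ?orbT //.
    by rewrite -[4%N]/(2 * 2)%N -!mulnA [(2 * (K * N))%N]mulnCA.
  have -> : (N * N = #|finset.setX A B'|)%N by rewrite cardsX AN BN.
  rewrite -[X in (_ <= _ + X + _)%N]AN.
  rewrite -(card_imset A (f := fun a => (a, a))); last by move=> a b [].
  rewrite -addnA; apply: leq_trans (leq_add (leqnn _) (leq_card_setU _ _)).
  apply: leq_trans (leq_card_setU _ _); apply/subset_leq_card/fintype.subsetP => -[a b].
  rewrite !inE /= => /andP[aA bB]; rewrite aA bB /= orbT.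
  have [ab|ab] /= := eqVneq a b; first by rewrite -ab (imset_f _ aA).
  case hab: (h [set a; b]) => [c1|] //=; apply/orP; right.
  rewrite /cadj ab /=; move: hab; rewrite hE /=.
  by case: (f _) => [c2|] //= _; rewrite inE.
have cX : (c <= #|XX h|)%N.
  by move: big ZX cN; move: #|Z| #|XX h| => z1 x1; clear; lia.
apply: (@le_trans _ _ ((1 - \sum_(t | B t) lw t) ^+ c)).
  by apply: ler_wiXn2l => //; rewrite gerBl sumr_ge0.
by rewrite lerXn2r // nnegrE subr_ge0.
Qed.

End FirstMoments.

(** * The finite bound *)

Lemma rainbow_connected_graph (V : finType) (E : {set {set V}}) (k : nat) :
  rainbow_colorable E k -> connected_graph E.
Proof.
case=> c [_ rainbow]; apply/forallP => x; apply/forallP => y.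
have [s /and4P[ps _ /eqP ls _]] := rainbow x y.
by apply/connectP; exists s.
Qed.

Lemma rainbow_path_size (V : finType) (E : {set {set V}}) (k : nat) (x y : V) :
  rainbow_colorable E k ->
  exists s, [/\ path (adj E) x s, uniq (x :: s), last x s = y & (size s <= k)%N].
Proof.
case=> c [ck rainbow]; have [s /and4P[ps us /eqP ls cs]] := rainbow x y.
exists s; split=> //; rewrite -(size_pairmap (fun u v => c [set u; v]) x s) -(size_iota 0 k).
apply: uniq_leq_size => // e.
elim: s x ps {us ls cs} => //= z s IH x /andP[xz ps]; rewrite inE => /orP[/eqP ->|].
  by rewrite mem_iota /= add0n ck.
exact: IH.
Qed.

Section Finitary.
Variables (R : realType) (n q : nat) (p : R).
Hypotheses (n_gt2 : (2 < n)%N) (q_gt1 : (1 < q)%N) (p_ge0 : 0 <= p) (p_le1 : p <= 1).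
Variables (delta L : R) (r m k b D K K' M c : nat) (T4 T5 : R).
Hypotheses (delta_ge0 : 0 <= delta) (delta_le1 : delta <= 1).
Hypotheses (qL : q%:R <= (1 + delta) * L) (rL : (1 - delta) * L <= r.+1%:R).
Hypotheses (k_gt0 : (0 < k)%N) (b_gt0 : (0 < b)%N) (K_gt0 : (0 < K)%N)
  (palette : (2 * (k + m + 4) + m + 4 <= q)%N) (branch : (2 * K * b.+1 + K' <= D)%N)
  (room : (2 * b ^ k <= M)%N) (pairs_large : (2 * c + b ^ k + 4 * K * b ^ k <= b ^ k * b ^ k)%N)
  (T4_ge1 : 1 <= T4) (T5_ge1 : 1 <= T5).

(** The failures are, in order: an isolated vertex, two adjacent vertices of degree below [D], a
    vertex with at least [K'] poor neighbours, a dense small set, a vertex with many edges in 3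
    colours, two unjoined reach sets, and a short path between two fixed vertices. *)
Let err1 := n%:R * (1 - p) ^+ n.-1.
Let err2 := n%:R * n%:R * (p * ((4^-1)^-1 ^+ D * (1 - (1 - 4^-1) * p) ^+ n.-2) ^+ 2).
Let err3 := n%:R * (n%:R * 2 ^+ q * p *
      ((2^-1)^-1 ^+ D * (1 - (1 - 2^-1) * (p * (m%:R / q%:R))) ^+ (n - K'.+1))) ^+ K'.
Let err4 := (1 + T4^-1 ^+ K * expR (T4 * p * M%:R)) ^+ n - 1.
Let err5 := n%:R * 2 ^+ q * (T5^-1 ^+ (D - K') * expR (T5 * (p * (3%:R / q%:R)) * n%:R)).
Let err6 := n%:R * n%:R * 2 ^+ q * (1 - p * (m%:R / q%:R)) ^+ c.
Let err7 := \sum_(j < r) n%:R ^+ j * p ^+ j.+1.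

(** If no failure occurs, the recolouring gives the upper bound. For the lower bound, pendant edges
    give [num_deg1], and fewer than [(1 - delta) * L] colours, hence at most [r], would force a path
    of at most [r] edges between [x0] and [x1]. *)
Lemma rc_bound_finite :
  1 - (err1 + (err2 + (err3 + (err4 + (err5 + (err6 + err7)))))) <=
  gnp_prob p (fun G : {set {set 'I_n}} =>
      let M := Num.max (num_deg1 G)%:R L in
      connected_graph G /\ (1 - delta) * M <= (rc G)%:R <= (1 + delta) * M).
Proof.
have q_gt0 : (0 < q)%N by apply: ltnW.
have lw0 := @label_weight_ge0 R q p p_ge0 p_le1.
have lw1 := @label_weight_sum1 R q p q_gt0.
rewrite (gnp_prob_label p q_gt0) (Pr_compl lw1) lerD2l lerN2.
(* Consecutive intervals of colours: [P1] and [P2] allow for [k] colours used on the walk, [m] for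
   richness and 4 forbidden ones, [P3] for the last two only. *)
pose P1 := [set a : 'I_q | (a < k + m + 4)%N].
pose P2 := [set a : 'I_q | (k + m + 4 <= a < 2 * (k + m + 4))%N].
pose P3 := [set a : 'I_q | (2 * (k + m + 4) <= a)%N].
have card_range (x y : nat) (Q : {set 'I_q}) : (y <= q)%N ->
    (forall a : 'I_q, (x <= a < y)%N -> a \in Q) -> (y - x <= #|Q|)%N.
  move=> yq xyQ.
  have lt (i : 'I_(y - x)) : (x + i < q)%N by move: yq (ltn_ord i); clear; lia.
  rewrite -[leqLHS]card_ord -(card_imset predT (f := fun i => Ordinal (lt i))); last first.
    by move=> i j /(congr1 val) /= /addnI /val_inj.
  apply/subset_leq_card/fintype.subsetP => a /imsetP[i _ ->]; apply: xyQ => /=.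
  by move: (ltn_ord i); clear; lia.
have cP1 : (k + m + 4 <= #|P1|)%N.
  apply: leq_trans (_ : k + m + 4 - 0 <= _)%N; first by rewrite subn0.
  by apply: card_range => [|a]; [move: palette; clear; lia | rewrite inE].
have cP2 : (k + m + 4 <= #|P2|)%N.
  apply: leq_trans (_ : 2 * (k + m + 4) - (k + m + 4) <= _)%N; first by move: palette; clear; lia.
  by apply: card_range => [|a]; [move: palette; clear; lia | rewrite inE].
have cP3 : (m + 4 <= #|P3|)%N.
  apply: leq_trans (_ : q - 2 * (k + m + 4) <= _)%N; first by move: palette; clear; lia.
  by apply: card_range => [|a]; [move: palette; clear; lia | rewrite inE => /andP[]].
have d12 : [disjoint P1 & P2].
  rewrite disjoint_subset; apply/fintype.subsetP => a; rewrite !inE => a1.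
  by rewrite negb_and -ltnNge a1.
have d3 : [disjoint P1 :|: P2 & P3].
  rewrite disjoint_subset; apply/fintype.subsetP => a; rewrite !inE -ltnNge => /orP[a1|/andP[_ //]].
  by apply: leq_trans a1 _; rewrite mul2n -addnn leq_addr.
have mq : (m <= q)%N by move: palette; clear; lia.
have E1 := @Pr_isolated R n q p q_gt0 p_ge0 p_le1.
have E2 := @Pr_small_adjacent R n q p q_gt0 p_ge0 p_le1 D 4^-1 ltac:(lra) ltac:(lra).
have E3 := @Pr_poor_neighbours R n q p q_gt0 p_ge0 p_le1 (P1 :|: P2) m D K' 2^-1
  ltac:(lra) ltac:(lra) mq.
have E4 := @Pr_dense_subset R n q p q_gt0 p_ge0 p_le1 K M T4 T4_ge1.
have E5 := @Pr_few_colours R n q p q_gt0 p_ge0 p_le1 3 (D - K') T5 T5_ge1.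
have E6 := @Pr_no_join R n q p q_gt0 p_ge0 p_le1 P1 P2 P3 m D K k (b ^ k) M c d3 cP3 room pairs_large.
pose x0 : 'I_n := Ordinal (ltn_trans (ltn0Sn 1) n_gt2).
pose x1 : 'I_n := Ordinal (ltn_trans (ltnSn 1) n_gt2).
have E7 := @Pr_short_path R n q p q_gt0 p_ge0 p_le1 r x0 x1 isT.
have H := Pr_or_le lw0 E1 (Pr_or_le lw0 E2 (Pr_or_le lw0 E3 (Pr_or_le lw0 E4
  (Pr_or_le lw0 E5 (Pr_or_le lw0 E6 E7))))).
apply: le_trans H; apply: Pr_le => // f nE; apply: contrapT => nbad; apply: nE.
move/not_orP: nbad => [n1 /not_orP[n2 /not_orP[n3 /not_orP[n4 /not_orP[n5 /not_orP[n6 n7]]]]]].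
have sparse (U : {set 'I_n}) : (#|U| <= M)%N ->
    (#|[set e : 'I_n * 'I_n | [&& e.1 \in U, e.2 \in U & cadj f [set: 'I_q] e.1 e.2]]|
       <= 2 * K * #|U|)%N.
  by move=> UM; rewrite leqNgt; apply/negP => dense; apply: n4; exists U.
have rainbow : rainbow_colorable (label_graph f) (maxn q (num_deg1 (label_graph f))).
  apply: (@label_graph_rainbow _ q f P1 P2 P3 m D K K' k b M) => //.
  - move=> x; apply: contrapT => iso; apply: n1; exists x => w.
    by apply/negP => xw; apply: iso; exists w.
  - move=> x y xy; have [Dx|xD] := leqP D (degree (label_graph f) x); first by left.
    have [Dy|yD] := leqP D (degree (label_graph f) y); first by right.
    by case: n2; exists x, y.
  - move=> u; rewrite leqNgt; apply/negP => poor; apply: n3; exists u.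
    exact: ltnW.
  - move=> x F F3; rewrite ltnNge; apply/negP => DF; apply: n5; exists x, F; split=> //.
    by rewrite leq_subLR addnC.
  - move=> x y F F4 NA NB; apply: contrapT => nj; apply: n6; split=> //.
    exists x, y, F; split=> // u v uA vB; apply/negP => uv; apply: nj.
    by exists u, v.
  - apply: leq_trans branch; apply: leq_trans (leq_addr _ _).
    by rewrite -mulnA leq_pmulr // muln_gt0 K_gt0.
move=> Mx; have conn := rainbow_connected_graph rainbow; split=> //.
have [rcc rcmin] := rcP conn.
have Z1rc : (num_deg1 (label_graph f) <= rc (label_graph f))%N.
  apply: num_deg1_le_colors rcc; last by rewrite card_ord.
  by apply/fintype.subsetP => e; rewrite inE => /andP[].
have Lpos : 0 <= L.
  have d1 : 0 < 1 + delta by rewrite ltr_wpDr.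
  by rewrite -(pmulr_rge0 _ d1); apply: le_trans qL.
have Lrc : (1 - delta) * L <= (rc (label_graph f))%:R.
  rewrite leNgt; apply/negP => rcL; apply: n7.
  have [s [ps us ls ss]] := rainbow_path_size x0 x1 rcc.
  exists s; split=> //; apply: leq_trans ss _.
  by rewrite -ltnS -(ltr_nat R); apply: lt_le_trans rL.
have M0 : 0 <= Mx by rewrite /Mx le_max Lpos orbT.
apply/andP; split.
  rewrite /Mx maxr_pMr ?subr_ge0 // ge_max Lrc andbT.
  apply: (@le_trans _ _ (num_deg1 (label_graph f))%:R); last by rewrite ler_nat.
  by rewrite ler_piMl // lerBlDr lerDl.
apply: (@le_trans _ _ (maxn q (num_deg1 (label_graph f)))%:R); first by rewrite ler_nat rcmin.
rewrite natr_max ge_max; apply/andP; split.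
  by apply: le_trans qL _; rewrite ler_wpM2l ?addr_ge0 // /Mx le_max lexx orbT.
apply: (@le_trans _ _ Mx); first by rewrite /Mx le_max lexx.
by rewrite ler_peMl // lerDl.
Qed.

End Finitary.

(** * Size of the error terms *)

Section ErrorTerms.
Variables (R : realType) (n : nat) (x l d p : R).
Hypotheses (n_gt0 : (0 < n)%N) (nE : n%:R = expR l) (lE : l = expR x)
  (pn : p * n%:R = d) (ld : l <= d) (dl : d <= 2 * l) (p_ge0 : 0 <= p) (p_le1 : p <= 1).

Lemma one_minus_pow (y : R) (j : nat) : y <= 1 -> (1 - y) ^+ j <= expR (- (y * j%:R)).
Proof.
move=> y1; rewrite -mulNr expRM_natr lerXn2r // ?nnegrE ?subr_ge0 ?expR_ge0 //.
exact: expR_ge1Dx.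
Qed.

Lemma two_le_expR1 : 2 <= expR 1 :> R.
Proof. by apply: le_trans (expR_ge1Dx _); lra. Qed.

Lemma pow2_le (j : nat) : 2 ^+ j <= expR j%:R :> R.
Proof. by rewrite -[j%:R]mul1r expRM_natr lerXn2r ?nnegrE ?expR_ge0 // two_le_expR1. Qed.

Lemma pow4_le (j : nat) : 4 ^+ j <= expR (2 * j%:R) :> R.
Proof.
have -> : 4 = 2 ^+ 2 :> R by lra.
by rewrite -exprM (le_trans (pow2_le _)) // natrM.
Qed.

(** Here [l] is [log n], [x] is [log log n] and [d] is [p n], so every factor becomes an exponential
    and the bounds reduce to linear inequalities. *)
Lemma d_le : d <= expR (1 + x).
Proof.
apply: le_trans dl _; rewrite expRD -lE ler_wpM2r ?two_le_expR1 //.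
by rewrite lE expR_ge0.
Qed.

(** The exponent is at most [1 - omega], as [d - l] is [omega]. This is the one error not bounded by
    a negative power of [n], and the reason why [omega] has to tend to infinity. *)
Lemma isolated_vertex_error : n%:R * (1 - p) ^+ n.-1 <= expR (1 - (d - l)).
Proof.
apply: le_trans (ler_wpM2l (ler0n _ _) (one_minus_pow _ p_le1)) _.
have -> : n.-1%:R = n%:R - 1 :> R by rewrite -subn1 natrB.
rewrite {1}nE -expRD ler_expR mulrBr pn mulr1; move: p_le1; lra.
Qed.

(** With weight [1/4] each end costs about [n^(-3/4)]; the square [n^(-3/2)] beats the [n * d] from
    the choice of the edge, and [kappa] is small enough for [4 ^+ D] to be absorbed. *)
Lemma small_adjacent_error (D : nat) (kappa : R) :
  D%:R <= kappa * l -> x + 4 + 4 * kappa * l <= l / 4 ->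
  n%:R * n%:R * (p * ((4^-1)^-1 ^+ D * (1 - (1 - 4^-1) * p) ^+ n.-2) ^+ 2) <= expR (- (l / 4)).
Proof.
have p1 := p_le1; have p0 := p_ge0; have ld1 := ld.
move=> Dl xl; set y := _ * _ ^+ n.-2.
have y0 : 0 <= y by rewrite mulr_ge0 ?exprn_ge0 ?invr_ge0 //; lra.
have yle : y <= expR (2 * (kappa * l) + 3 / 2 - 3 / 4 * l).
  apply: (@le_trans _ _ (expR (2 * D%:R) * expR (- ((1 - 4^-1) * p * n.-2%:R)))).
    rewrite /y invrK; apply: ler_pM; rewrite ?exprn_ge0 ?pow4_le //; first by lra.
    by apply: one_minus_pow; lra.
  have n2 : n%:R - 2 <= n.-2%:R :> R.
    by rewrite lerBlDr -natrD ler_nat; move: n_gt0; clear; lia.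
  rewrite -expRD ler_expR; have := ler_wpM2l p_ge0 n2; rewrite mulrBr pn; lra.
have -> : n%:R * n%:R * (p * y ^+ 2) = n%:R * d * y ^+ 2 by rewrite -pn; ring.
apply: (@le_trans _ _ (expR l * expR (1 + x) * expR (2 * (kappa * l) + 3 / 2 - 3 / 4 * l) ^+ 2)).
  have d0 : 0 <= d by rewrite (le_trans _ ld) // lE expR_ge0.
  apply: ler_pM; [by rewrite mulr_ge0|exact: exprn_ge0| |].
    by rewrite nE ler_wpM2l ?expR_ge0 ?d_le.
  by rewrite lerXn2r ?nnegrE ?expR_ge0.
by rewrite -expRM_natr -!expRD ler_expR; lra.
Qed.

(** Each poor neighbour costs [expR (- (theta / 4 * l))]. As [theta * K'] is at least 8, together
    they give [expR (- (2 * l))], against [expR l] choices of the vertex. *)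
Lemma poor_neighbours_error (q D K' : nat) (theta mu : R) : 0 < theta -> theta <= mu -> mu <= 1 ->
  1 + x + q%:R + D%:R + theta / 2 * (K'.+1)%:R <= theta / 4 * l -> 8 <= theta * K'%:R ->
  n%:R * (n%:R * 2 ^+ q * p *
      ((2^-1)^-1 ^+ D * (1 - (1 - 2^-1) * (p * mu)) ^+ (n - K'.+1))) ^+ K' <= expR (- l).
Proof.
have p1 := p_le1; have p0 := p_ge0; have ld1 := ld.
move=> t0 tmu mu1 hl hK; have l0 : 0 <= l by rewrite lE expR_ge0.
have pmu0 : 0 <= p * mu by rewrite mulr_ge0 // (le_trans _ tmu) // ltW.
have pmu1 : p * mu <= 1 by rewrite mulr_ile1 // (le_trans _ tmu) // ltW.
set y := _ * (_ ^+ D * _).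
have y0 : 0 <= y by rewrite !mulr_ge0 ?exprn_ge0 ?invr_ge0 //; lra.
have yle : y <= expR (- (theta / 4 * l)).
  rewrite /y invrK.
  apply: (@le_trans _ _ (expR (1 + x) * expR q%:R * (expR D%:R *
     expR (- ((1 - 2^-1) * (p * mu) * (n - K'.+1)%:R))))).
    apply: ler_pM; rewrite ?mulr_ge0 ?exprn_ge0 //; first by lra.
      rewrite mulrAC [_ * p]mulrC pn; apply: ler_pM; rewrite ?exprn_ge0 ?d_le ?pow2_le //.
      exact: le_trans ld.
    apply: ler_pM; rewrite ?exprn_ge0 ?pow2_le //; first by lra.
    by apply: one_minus_pow; lra.
  rewrite -!expRD ler_expR.
  have nK : n%:R - (K'.+1)%:R <= (n - K'.+1)%:R :> R.
    by rewrite lerBlDr -natrD ler_nat; clear; lia.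
  have : theta * (l - K'.+1%:R) <= p * mu * (n - K'.+1)%:R.
    apply: (@le_trans _ _ (p * theta * (n - K'.+1)%:R)); last first.
      by rewrite ler_wpM2r // ler_wpM2l.
    apply: (@le_trans _ _ (p * theta * (n%:R - K'.+1%:R))); last first.
      by rewrite ler_wpM2l ?mulr_ge0 // ltW.
    rewrite [p * theta]mulrC -mulrA ler_wpM2l ?(ltW t0) // mulrBr pn lerB //.
    by rewrite ler_piMl.
  move: hl; move: (K'.+1)%:R (n - K'.+1)%:R => a b hl; nra.
apply: (@le_trans _ _ (expR l * expR (- (theta / 4 * l)) ^+ K')).
  by rewrite nE ler_wpM2l ?expR_ge0 // lerXn2r ?nnegrE ?expR_ge0.
rewrite -expRM_natr -expRD ler_expR.
have := ler_wpM2r l0 hK; nra.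
Qed.

(** [T] is [n^(1/8)], so its power [-16] is [n^(-2)], while [M] of order [n^(5/8)] keeps [T * p * M]
    below 1. Hence [y * n] is of order [1/n], and so is the whole term. *)
Lemma dense_subset_error (M : nat) : M%:R <= expR (5 / 8 * l + 1) -> x + 2 <= l / 4 -> 2 <= l ->
  (1 + (expR (l / 8))^-1 ^+ 16 * expR (expR (l / 8) * p * M%:R)) ^+ n - 1 <= expR (2 - l).
Proof.
have p1 := p_le1; have p0 := p_ge0; have ld1 := ld.
move=> hM hx l2; set y := _ * expR _.
have pM : expR (l / 8) * p * M%:R <= 1.
  have pE : p = d * expR (- l).
    by rewrite -pn nE -mulrA -expRD subrr expR0 mulr1.
  apply: (@le_trans _ _ (expR (l / 8) * (expR (1 + x) * expR (- l)) * expR (5 / 8 * l + 1))).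
    apply: ler_pM; rewrite ?mulr_ge0 ?expR_ge0 // ler_wpM2l ?expR_ge0 // pE.
    by rewrite ler_wpM2r ?expR_ge0 ?d_le.
  by rewrite -!expRD expR_le1; lra.
have yle : y <= expR (1 - 2 * l).
  apply: (@le_trans _ _ ((expR (l / 8))^-1 ^+ 16 * expR 1)).
    by rewrite ler_wpM2l ?ler_expR // exprn_ge0 // invr_ge0 expR_ge0.
  by rewrite -expRN -expRM_natr -expRD ler_expR; lra.
have y0 : 0 <= y by rewrite mulr_ge0 ?expR_ge0 // exprn_ge0 // invr_ge0 expR_ge0.
have zle : y * n%:R <= expR (1 - l).
  apply: (@le_trans _ _ (expR (1 - 2 * l) * n%:R)); first by rewrite ler_wpM2r.
  by rewrite nE -expRD ler_expR; lra.
have half : expR (1 - l) <= 2^-1.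
  apply: (@le_trans _ _ (expR (- 1))); first by rewrite ler_expR; lra.
  by rewrite expRN lef_pV2 ?posrE ?expR_gt0 ?two_le_expR1.
have exp_lin (z : R) : 0 <= z -> z <= 2^-1 -> expR z - 1 <= 2 * z.
  move=> z0 z1; have := expR_ge1Dx (- z); rewrite expRN => h.
  have := expR_gt0 z => e0.
  have : (1 - z) * expR z <= 1.
    by rewrite -ler_pdivlMr // div1r.
  by nra.
apply: (@le_trans _ _ (expR (y * n%:R) - 1)).
  rewrite lerD2r expRM_natr lerXn2r // ?nnegrE ?expR_ge0 ?addr_ge0 //.
  exact: expR_ge1Dx.
apply: le_trans (exp_lin _ _ _) _; rewrite ?mulr_ge0 ?(le_trans zle) //.
apply: (@le_trans _ _ (expR 1 * expR (1 - l))); last by rewrite -expRD ler_expR; lra.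
by apply: ler_pM; rewrite ?mulr_ge0 ?two_le_expR1.
Qed.

(** Three colours carry on average only [3 d / q <= 6 x] edges at a vertex. The constant
    [T = expR (8 / kappa)] turns [D' >= kappa / 2 * l] into a factor [expR (- (4 * l))]. *)
Lemma few_colours_error (q D' : nat) (kappa : R) : (0 < q)%N -> 0 < kappa -> kappa / 2 * l <= D'%:R ->
  l <= x * q%:R -> q%:R + 6 * expR (8 / kappa) * x <= l ->
  n%:R * 2 ^+ q * ((expR (8 / kappa))^-1 ^+ D' *
    expR (expR (8 / kappa) * (p * (3%:R / q%:R)) * n%:R)) <= expR (- l).
Proof.
have l0 : 0 <= l by rewrite lE expR_ge0.
have p1 := p_le1; have p0 := p_ge0; have ld1 := ld.
move=> q0 k0 hD hq hl; set T := expR (8 / kappa) in hl *.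
have q0' : 0 < q%:R :> R by rewrite ltr0n.
apply: (@le_trans _ _ (expR l * expR q%:R * (expR (- (8 / kappa * D'%:R)) * expR (6 * T * x)))).
  apply: ler_pM; rewrite ?mulr_ge0 ?exprn_ge0 ?invr_ge0 ?expR_ge0 //.
    by rewrite nE ler_wpM2l ?expR_ge0 ?pow2_le.
  rewrite -expRN -expRM_natr mulNr ler_wpM2l ?expR_ge0 // ler_expR.
  have -> : T * (p * (3 / q%:R)) * n%:R = T * (3 * (d / q%:R)) by rewrite -pn; ring.
  have : d / q%:R <= 2 * x.
    by rewrite ler_pdivrMr // (le_trans dl) // -mulrA ler_wpM2l.
  have := expR_ge0 (8 / kappa); rewrite -/T; nra.
rewrite -!expRD ler_expR.
have : 4 * l <= 8 / kappa * D'%:R.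
  apply: (@le_trans _ _ (8 / kappa * (kappa / 2 * l))); last by rewrite ler_wpM2l // divr_ge0 // ltW.
  rewrite le_eqVlt; apply/orP; left; apply/eqP; field; exact: lt0r_neq0.
lra.
Qed.

(** As [c] is at least [n^(1 + eta) / 8], [p * c] is at least [l * n^eta / 8]; so the exponent
    exceeds [4 * l] and beats [n * n * 2 ^+ q]. *)
Lemma no_join_error (q c : nat) (theta mu eta : R) : 0 < theta -> theta <= mu -> mu <= 1 ->
  expR ((1 + eta) * l) <= 8 * c%:R -> 32 <= theta * expR (eta * l) -> 2 * q%:R <= l ->
  n%:R * n%:R * 2 ^+ q * (1 - p * mu) ^+ c <= expR (- l).
Proof.
have p1 := p_le1; have p0 := p_ge0; have ld1 := ld.
move=> t0 tmu mu1 hc he hq; have l0 : 0 <= l by rewrite lE expR_ge0.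
have pmu1 : p * mu <= 1 by rewrite mulr_ile1 // (le_trans _ tmu) // ltW.
have mu0 : 0 < mu by apply: lt_le_trans tmu.
apply: (@le_trans _ _ (expR l * expR l * expR q%:R * expR (- (p * mu * c%:R)))).
  apply: ler_pM; rewrite ?mulr_ge0 ?exprn_ge0 ?subr_ge0 ?one_minus_pow //.
  by rewrite nE ler_wpM2l ?mulr_ge0 ?expR_ge0 ?pow2_le.
rewrite -!expRD ler_expR.
have : 4 * l <= p * mu * c%:R.
  have n0 : 0 < n%:R :> R by rewrite ltr0n.
  have pc : l * expR (eta * l) <= 8 * (p * c%:R).
    have e1 : expR ((1 + eta) * l) = n%:R * expR (eta * l).
      by rewrite nE -expRD mulrDl mul1r.
    have h : d * expR (eta * l) <= p * (8 * c%:R) by rewrite -pn -mulrA -e1 ler_wpM2l.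
    apply: le_trans (_ : d * expR (eta * l) <= _); first by rewrite ler_wpM2r ?expR_ge0.
    by apply: le_trans h _; rewrite le_eqVlt; apply/orP; left; apply/eqP; ring.
  have pc0 : 0 <= p * c%:R by rewrite mulr_ge0.
  have : 32 * l <= 8 * (theta * (p * c%:R)).
    apply: (@le_trans _ _ (theta * (l * expR (eta * l)))).
      by rewrite [leRHS]mulrCA [leLHS]mulrC ler_wpM2l.
    by rewrite [leRHS]mulrCA ler_wpM2l // ltW.
  have : theta * (p * c%:R) <= mu * (p * c%:R) by rewrite ler_wpM2r.
  rewrite [p * mu]mulrC -mulrA; lra.
lra.
Qed.

(** Each term equals [d ^+ j.+1 / n], at most [d ^+ r / n], and [x * r <= (1 - delta) * l] makes
    [d ^+ r] at most [n^(1 - delta)] up to a factor [expR r%:R]. *)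
Lemma short_path_error (r : nat) (delta : R) : 1 <= l -> 0 <= delta ->
  x * r%:R <= (1 - delta) * l -> 2 * r%:R <= delta / 2 * l -> 
  \sum_(j < r) n%:R ^+ j * p ^+ j.+1 <= expR (- (delta / 2 * l)).
Proof.
move=> l1 d0 hr hx; have d1 : 1 <= d by apply: le_trans ld.
have n0 : 0 < n%:R :> R by rewrite ltr0n.
apply: (@le_trans _ _ (\sum_(j < r) (expR (- l) * d ^+ r))).
  apply: ler_sum => j _.
  have -> : n%:R ^+ j * p ^+ j.+1 = expR (- l) * d ^+ j.+1.
    rewrite -pn exprMn [n%:R ^+ j.+1]exprS expRN -nE; field; exact: lt0r_neq0.
  by rewrite ler_wpM2l ?expR_ge0 // ler_weXn2l.
rewrite sumr_const card_ord -[leLHS]mulr_natl.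
apply: (@le_trans _ _ (expR r%:R * (expR (- l) * expR (1 + x) ^+ r))).
  apply: ler_pM; rewrite ?mulr_ge0 ?expR_ge0 ?exprn_ge0 // ?(le_trans _ d1) //.
    by apply: le_trans (expR_ge1Dx _); rewrite lerDr.
  by rewrite ler_wpM2l ?expR_ge0 // lerXn2r ?nnegrE ?expR_ge0 ?d_le // (le_trans _ d1).
have := ler0n R r => r0.
rewrite -expRM_natr -!expRD ler_expR.
lra.
Qed.

End ErrorTerms.

(** * Choice of the parameters *)

Section ParameterChoice.
Variables (R : realType) (delta theta kappa lam C T5 x l L d : R) (K' n q r m k D b : nat).
Hypotheses (delta_gt0 : 0 < delta) (delta_le : delta <= 2^-1).
Hypotheses (thetaE : theta = delta / 32) (kappaE : kappa = theta / 64) (lamE : lam = kappa / 64).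
Hypotheses (C_ge0 : 0 <= C) (CE : expR (- C) = lam / 2) (T5E : T5 = expR (8 / kappa)).
Hypothesis K'_large : 8 <= theta * K'%:R.
Hypotheses (x_gt0 : 0 < x) (lE : l = expR x) (xL : x * L = l) (L_gt0 : 0 < L).
Hypotheses (g0 : 300 * x + 300 <= l) (g1 : 40 <= delta * L) (g2 : 33 + K'%:R <= kappa / 2 * l)
  (g3 : 2 <= lam * l) (g4 : 1 + x + theta / 2 * K'.+1%:R <= theta / 8 * l)
  (g5 : 12 * T5 * x <= l) (g6 : 32 <= theta * (delta / 8 * l)) (gL : (1 + C) * L <= theta / 96 * l).
Hypotheses (q_le : q%:R <= (1 + delta) * L) (q_gt : (1 + delta) * L < q%:R + 1).
Hypotheses (r_le : r%:R <= (1 - delta) * L) (r_gt : (1 - delta) * L < r%:R + 1).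
Hypotheses (m_le : m%:R <= delta / 8 * L) (m_gt : delta / 8 * L < m%:R + 1).
Hypotheses (k_le : k%:R <= (2^-1 + delta / 8) * L + 1) (k_gt : (2^-1 + delta / 8) * L < k%:R).
Hypotheses (D_le : D%:R <= kappa * l) (D_gt : kappa * l < D%:R + 1).
Hypotheses (b_le : b%:R <= lam * l) (b_gt : lam * l < b%:R + 1).
Hypotheses (nE : n%:R = expR l) (ld : l <= d) (dl : d <= 2 * l).

Let l_ge300 : 300 <= l.
Proof. by have := x_gt0; have := g0; lra. Qed.

Let L_ge80 : 80 <= L.
Proof. by have := g1; have := delta_le; have := L_gt0; nra. Qed.

Let L_small : L <= theta / 96 * l.
Proof. by have := gL; have := C_ge0; have := L_gt0; nra. Qed.

(** The left side is [2 k + 3 m + 12], at most [(1 + 5/8 delta) L + 14]; the remaining [3/8 delta L]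
    is at least 15 by [g1]. *)
Let palette_fits : (2 * (k + m + 4) + m + 4 <= q)%N.
Proof.
rewrite -ltnS -(ltr_nat R) -[q.+1%:R]natr1 2!natrD natrM 2!natrD.
by have := g1; have := k_le; have := m_le; have := q_gt; lra.
Qed.

Let q_le_L : q%:R <= 3 / 2 * L.
Proof. by have := q_le; have := delta_le; have := L_gt0; nra. Qed.

Let q_ge_L : L <= q%:R.
Proof. by have := q_gt; have := g1; lra. Qed.

Let q_gt1 : (1 < q)%N.
Proof. by rewrite -(ltr_nat R); have := q_ge_L; have := L_ge80; lra. Qed.

Let theta_ratio : theta <= m%:R / q%:R.
Proof.
have q0 : 0 < q%:R :> R by rewrite ltr0n; apply: ltnW; exact: q_gt1.
rewrite ler_pdivlMr // thetaE.
have := q_le_L; have := m_gt; have := g1; have := delta_gt0; nra.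
Qed.

Let ratio_le1 : m%:R / q%:R <= 1 :> R.
Proof.
have q0 : 0 < q%:R :> R by rewrite ltr0n; apply: ltnW; exact: q_gt1.
rewrite ler_pdivrMr // mul1r ler_nat.
by have := palette_fits; clear; lia.
Qed.

(** [lam = kappa / 64] keeps [32 * b] below half of [kappa * l]; the other half absorbs the
    constants by [g2]. *)
Let branching_fits : (2 * 16 * b.+1 + K' <= D)%N.
Proof.
rewrite -ltnS -(ltr_nat R) -[D.+1%:R]natr1 natrD natrM -[b.+1%:R]natr1 natrM.
by have := g2; have := D_gt; have := b_le; rewrite lamE; lra.
Qed.

Let b_gt0 : (0 < b)%N.
Proof. by rewrite -(ltr_nat R); have := g3; have := b_gt; lra. Qed.

Let k_gt0 : (0 < k)%N.
Proof. by rewrite -(ltr_nat R); have := k_gt; have := g1; have := L_ge80; lra. Qed.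

(** From [b <= expR x] and [x * L = l] the exponent is at most [(1/2 + delta/8) l + x], and
    [delta <= 1/2] makes the coefficient at most [9/16]. *)
Let power_le : (b ^ k)%:R <= expR (5 / 8 * l).
Proof.
have lam1 : lam <= 1 by rewrite lamE kappaE thetaE; have := delta_le; lra.
have bx : b%:R <= expR x.
  by rewrite -lE; have := b_le; have := l_ge300; nra.
rewrite natrX; apply: (@le_trans _ _ (expR x ^+ k)); first by rewrite lerXn2r ?nnegrE ?expR_ge0 ?ler0n.
rewrite -expRM_natr ler_expR.
apply: (@le_trans _ _ (x * ((2^-1 + delta / 8) * L + 1))); first by rewrite ler_wpM2l // ltW.
rewrite mulrDr mulr1 mulrCA xL; have := g0; have := delta_le; have := l_ge300; nra.
Qed.

(** Having [b >= expR (x - C)] in place of [expR x] loses a constant factor per step, in total an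
    exponent of order [C * L], which [gL] makes a small multiple of [delta * l]; the drop from
    [delta / 8] to [delta / 16] pays for it. *)
Let power_ge : expR ((2^-1 + delta / 16) * l) <= (b ^ k)%:R.
Proof.
have bx : expR (x - C) <= b%:R.
  by rewrite expRD CE -lE; have := g3; have := b_gt; lra.
rewrite natrX; apply: (@le_trans _ _ (expR (x - C) ^+ k)); last first.
  by rewrite lerXn2r ?nnegrE ?expR_ge0 ?ler0n.
rewrite -expRM_natr ler_expR.
have C_le : C * L <= delta / 96 * l.
  have := gL; have := L_gt0; rewrite thetaE; have := l_ge300; have := delta_gt0; nra.
have xC : 0 <= x - C.
  have : C * L <= x * L.
    have l3 := l_ge300; have dl2 : delta * l <= 2^-1 * l by rewrite ler_wpM2r //; lra.
    by rewrite xL; lra.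
  by rewrite ler_pM2r // subr_ge0.
apply: (@le_trans _ _ ((x - C) * ((2^-1 + delta / 8) * L))); last first.
  by rewrite ler_wpM2l // ltW.
have -> : (x - C) * ((2^-1 + delta / 8) * L) = (2^-1 + delta / 8) * (l - C * L).
  by rewrite -xL; ring.
have CL0 : 0 <= C * L by rewrite mulr_ge0 // ltW.
have l0 : 0 <= l by have := l_ge300; lra.
have := ler_wpM2r CL0 delta_le; have := mulr_ge0 (ltW delta_gt0) l0.
move: (C * L) C_le => y; lra.
Qed.

Let power_large : (130 <= b ^ k)%N.
Proof.
rewrite -(ler_nat R); apply: le_trans power_ge; apply: le_trans (expR_ge1Dx _).
by have := l_ge300; have := delta_gt0; nra.
Qed.

(** With [N = b ^ k], the first term is at most half of [N * N], and [N >= 130] leaves the other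
    half for [65 * N]. *)
Let pairs_fit : (2 * (b ^ k * b ^ k %/ 4) + b ^ k + 4 * 16 * b ^ k <= b ^ k * b ^ k)%N.
Proof.
have := power_large; move: (b ^ k)%N => N N1.
have : (130 * N <= N * N)%N by rewrite leq_mul2r N1 orbT.
by move: (N * N)%N => NN; clear; lia.
Qed.

Let p_le1 : d / n%:R <= 1.
Proof.
rewrite ler_pdivrMr ?nE ?expR_gt0 // mul1r (le_trans dl) //.
have l3 := l_ge300; apply: le_trans (expR_ge1Dxn 1 _); last by lra.
by rewrite (_ : 2`!%:R = 2) // expr2; nra.
Qed.

Let n_gt2 : (2 < n)%N.
Proof.
rewrite -(ltr_nat R) nE; apply: lt_le_trans (expR_ge1Dx _).
by have := l_ge300; lra.
Qed.

Lemma rc_bound_of_parameters :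
  1 - (expR (1 - (d - l)) + 6 * expR (- (delta / 2 * l))) <=
    gnp_prob (d / n%:R) (fun G : {set {set 'I_n}} =>
      let M := Num.max (num_deg1 G)%:R L in
      connected_graph G /\ (1 - delta) * M <= (rc G)%:R <= (1 + delta) * M).
Proof.
have n0 : (0 < n)%N by apply: leq_trans n_gt2.
have l0 := l_ge300.
have p0 : 0 <= d / n%:R by rewrite divr_ge0 // (le_trans _ ld) //; lra.
have pn : d / n%:R * n%:R = d by rewrite divfK // pnatr_eq0 -lt0n.
have delta1 : delta <= 1 by have := delta_le; lra.
have q0 : (0 < q)%N by apply: ltnW; exact: q_gt1.
have T41 : 1 <= expR (l / 8) by rewrite -[leLHS]expR0 ler_expR; lra.
have kap0 : 0 < kappa by rewrite kappaE thetaE; have := delta_gt0; lra.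
have th0 : 0 < theta by rewrite thetaE; have := delta_gt0; lra.
have T51 : 1 <= expR (8 / kappa) by rewrite -[leLHS]expR0 ler_expR divr_ge0 // ltW.
have rL : (1 - delta) * L <= r.+1%:R by rewrite -natr1 ltW.
apply: le_trans _ (@rc_bound_finite R n q (d / n%:R) n_gt2 q_gt1 p0 p_le1 delta L r m k b D 16 K'
  (2 * b ^ k) (b ^ k * b ^ k %/ 4) (expR (l / 8)) (expR (8 / kappa)) (ltW delta_gt0) delta1
  q_le rL k_gt0 b_gt0 isT palette_fits branching_fits (leqnn _) pairs_fit T41 T51).
rewrite lerD2l lerN2.
have tail (y : R) : delta / 2 * l <= y -> expR (- y) <= expR (- (delta / 2 * l)).
  by move=> ly; rewrite ler_expR lerN2.
have hq := q_le_L; have hL := L_small.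
(* By [delta <= 1/2] the bound [expR (- (l / 4))] for adjacent small vertices also falls under the
   common tail. *)
have dl8 : delta / 2 * l <= l / 4.
  by rewrite [l / 4]mulrC ler_wpM2r //; have := delta_le; lra.
have th1 : theta <= 1 by rewrite thetaE; have := delta_le; lra.
have thl : theta * l <= l by rewrite ler_piMl //; lra.
have tl0 : 0 <= theta * l by apply: mulr_ge0; [exact: ltW | lra].
have kl : kappa * l = theta * l / 64 by rewrite kappaE; ring.
rewrite (_ : 6 * expR _ = expR (- (delta / 2 * l)) + (expR (- (delta / 2 * l)) +
  (expR (- (delta / 2 * l)) + (expR (- (delta / 2 * l)) + (expR (- (delta / 2 * l)) +
   expR (- (delta / 2 * l))))))); last by ring.
apply: lerD; first exact: isolated_vertex_error n0 nE pn p_le1.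
apply: lerD.
  apply: le_trans (small_adjacent_error n0 nE lE pn ld dl p0 p_le1 D_le _) _; last exact: tail.
  by have := g0; have := x_gt0; lra.
apply: lerD.
  apply: le_trans (poor_neighbours_error nE lE pn ld dl p0 p_le1 th0
    theta_ratio ratio_le1 _ K'_large) _.
    by have := g4; have := D_le; lra.
  by apply: tail; lra.
apply: lerD.
  apply: le_trans (dense_subset_error nE lE pn ld dl p0 p_le1 _ _ _) _.
  - rewrite natrM expRD mulrC; apply: ler_pM => //; exact: two_le_expR1.
  - by have := g0; have := x_gt0; lra.
  - by lra.
  - by rewrite -[2 - l]opprB; apply: tail; lra.
apply: lerD.
  apply: le_trans (few_colours_error nE lE pn ld dl p0 p_le1 q0 kap0 _ _ _) _.
  - rewrite natrB; last by apply: leq_trans branching_fits; exact: leq_addl.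
    by have := g2; have := D_gt; lra.
  - by rewrite -{1}xL ler_wpM2l ?q_ge_L // ltW.
  - by rewrite -T5E; have := g5; lra.
  - by apply: tail; lra.
apply: lerD.
  apply: le_trans (no_join_error n0 nE lE pn ld p0 p_le1 th0 theta_ratio ratio_le1 _ _ _) _.
  - have := power_large; have := power_ge; move: (b ^ k)%N => N Nge N130.
    have NN : expR ((1 + delta / 8) * l) <= (N * N)%:R.
      rewrite natrM (_ : (1 + delta / 8) * l = (2^-1 + delta / 16) * l + (2^-1 + delta / 16) * l);
        last by field.
      by rewrite expRD; apply: ler_pM => //; exact: expR_ge0.
    apply: le_trans NN _; rewrite -natrM ler_nat.
    have : (130 * N <= N * N)%N by rewrite leq_mul2r N130 orbT.
    by move: N130; move: (N * N)%N => NN; clear; lia.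
  - rewrite (le_trans g6) // ler_wpM2l ?(ltW th0) //.
    by apply: le_trans (expR_ge1Dx _); rewrite lerDr.
  - by lra.
  - by apply: tail; lra.
apply: (short_path_error n0 nE lE pn ld dl _ (ltW delta_gt0) _ _).
- by lra.
- by rewrite -xL mulrCA ler_wpM2l // ltW.
- have := r_le; have := delta_gt0; have := L_gt0 => L0 dg rl.
  have : delta * L >= 0 by rewrite mulr_ge0 // ltW.
  by move: hL rl; rewrite thetaE; move=> *; nra.
Qed.

End ParameterChoice.

(** * Asymptotics *)

Local Open Scope classical_set_scope.
Local Open Scope ring_scope.

Lemma expR_dominates (R : realType) (A B eta : R) : 0 < eta ->
  \forall x \near +oo, A * x + B <= eta * expR x.
Proof.
move=> eta0; near=> x.
have x1 : 1 <= x by near: x; apply: nbhs_pinfty_ge; exact: num_real.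
have xAB : 2 * (`|A| + `|B|) <= eta * x.
  rewrite [leRHS]mulrC -ler_pdivrMr //; near: x; apply: nbhs_pinfty_ge; exact: num_real.
have e2 : x ^+ 2 / 2 <= expR x.
  apply: le_trans (expR_ge1Dxn 1 _); last by lra.
  by rewrite (_ : 2`!%:R = 2) // lerDr.
have AB : A * x + B <= (`|A| + `|B|) * x.
  have x0 : 0 <= x by lra.
  rewrite mulrDl lerD // ?ler_wpM2r ?ler_norm //.
  by rewrite (le_trans (ler_norm B)) // ler_peMr.
apply: le_trans AB _; apply: (@le_trans _ _ (eta * (x ^+ 2 / 2))); last by rewrite ler_wpM2l // ltW.
rewrite expr2; move: xAB; move: (`|A| + `|B|) => y xy; nra.
Unshelve. all: by end_near. Qed.

Lemma cvg_ln_pinfty (R : realType) (u : nat -> R) :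
  u n @[n --> \oo] --> +oo -> ln (u n) @[n --> \oo] --> +oo.
Proof.
move=> /cvgryPge uoo; apply/cvgryPge => A.
near=> n.
have uA : expR A <= u n by near: n; exact: uoo.
by rewrite -[A]expRK ler_ln // posrE ?(lt_le_trans _ uA) ?expR_gt0.
Unshelve. all: by end_near. Qed.

(** A real [x] plays the role of [log log n], and the bound is uniform in [d] and [n], so that every
    largeness condition concerns [x] alone. *)
Lemma rc_bound_near_infinity (R : realType) (delta : R) : 0 < delta -> delta <= 2^-1 ->
  \forall x \near +oo, forall (d : R) (n : nat),
    n%:R = expR (expR x) -> expR x <= d -> d <= 2 * expR x ->
    1 - (expR (1 - (d - expR x)) + 6 * expR (- (delta / 2 * expR x))) <=
    gnp_prob (d / n%:R) (fun G : {set {set 'I_n}} =>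
      let M := Num.max (num_deg1 G)%:R (expR x / x) in
      connected_graph G /\ (1 - delta) * M <= (rc G)%:R <= (1 + delta) * M).
Proof.
move=> d0 d2.
pose theta := delta / 32; pose kappa := theta / 64; pose lam := kappa / 64.
pose T5 := expR (8 / kappa); pose C := - ln (lam / 2).
pose K' := (Num.truncn (8 / theta)).+1.
have theta0 : 0 < theta by rewrite /theta; lra.
have kappa0 : 0 < kappa by rewrite /kappa; lra.
have lam0 : 0 < lam by rewrite /lam; lra.
have CE : expR (- C) = lam / 2 by rewrite opprK lnK // posrE divr_gt0.
have C0 : 0 <= C by rewrite oppr_ge0 ln_le0 // /lam /kappa /theta; lra.
have hK' : 8 <= theta * K'%:R by rewrite mulrC -ler_pdivrMr // ltW // truncnS_gt.
have [c1 c2 c3 c4] : [/\ 0 <= 1 + delta, 0 <= 1 - delta, 0 <= delta / 8 & 0 <= 2^-1 + delta / 8].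
  by split; lra.
near=> x => d n nE ld dl.
have x0 : 0 < x by near: x; apply: nbhs_pinfty_gt; exact: num_real.
pose l := expR x; pose L := l / x.
have xL : x * L = l by rewrite /L mulrC divfK // gt_eqF.
have L0 : 0 < L by rewrite divr_gt0 // expR_gt0.
have l0 : 0 < l by exact: expR_gt0.
have g0 : 300 * x + 300 <= l.
  rewrite -[leRHS]mul1r; rewrite /l; near: x; exact: expR_dominates.
have g1 : 40 <= delta * L.
  rewrite /L mulrA ler_pdivlMr // -[leLHS]addr0; rewrite /l; near: x; exact: expR_dominates.
have g2 : 33 + K'%:R <= kappa / 2 * l.
  rewrite -[leLHS]add0r -{1}[0](mul0r x); rewrite /l; near: x; apply: expR_dominates; exact: divr_gt0.
have g3 : 2 <= lam * l.
  rewrite -[leLHS]add0r -{1}[0](mul0r x); rewrite /l; near: x; exact: expR_dominates.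
have g4 : 1 + x + theta / 2 * K'.+1%:R <= theta / 8 * l.
  rewrite (_ : 1 + x + _ = 1 * x + (1 + theta / 2 * K'.+1%:R)); last by ring.
  rewrite /l; near: x; apply: expR_dominates; exact: divr_gt0.
have g5 : 12 * T5 * x <= l.
  rewrite -[leLHS]addr0 -[leRHS]mul1r; rewrite /l; near: x; exact: expR_dominates.
have g6 : 32 <= theta * (delta / 8 * l).
  rewrite -[leLHS]add0r -{1}[0](mul0r x) mulrA; rewrite /l; near: x; apply: expR_dominates.
  by rewrite mulr_gt0 // divr_gt0.
(* After division by [L] this only asks that [x] exceed a constant depending on [delta]. *)
have gL : (1 + C) * L <= theta / 96 * l.
  rewrite -xL mulrA ler_wpM2r ?(ltW L0) // mulrC -ler_pdivrMr ?divr_gt0 //.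
have tr (y : R) : 0 <= y -> (Num.truncn y)%:R <= y /\ y < (Num.truncn y)%:R + 1.
  by move=> y0; have := truncn_itv y0; rewrite -natr1 => /andP[].
have [q_le q_gt] := tr ((1 + delta) * L) (mulr_ge0 c1 (ltW L0)).
have [r_le r_gt] := tr ((1 - delta) * L) (mulr_ge0 c2 (ltW L0)).
have [m_le m_gt] := tr (delta / 8 * L) (mulr_ge0 c3 (ltW L0)).
have [D_le D_gt] := tr (kappa * l) (mulr_ge0 (ltW kappa0) (ltW l0)).
have [b_le b_gt] := tr (lam * l) (mulr_ge0 (ltW lam0) (ltW l0)).
have [k_le k_gt] := tr ((2^-1 + delta / 8) * L) (mulr_ge0 c4 (ltW L0)).
apply: (@rc_bound_of_parameters R delta theta kappa lam C T5 x l L d K' n _ _ _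
  (Num.truncn ((2^-1 + delta / 8) * L)).+1 _ _ d0 d2 erefl erefl erefl C0 CE erefl hK' x0 erefl
  xL L0 g0 g1 g2 g3 g4 g5 g6 gL q_le q_gt r_le r_gt m_le m_gt _ _ D_le D_gt b_le b_gt nE ld dl).
- by rewrite -[leLHS]natr1 lerD2r.
- by rewrite -[ltRHS]natr1.
Unshelve. all: by end_near. Qed.

Lemma gnp_prob_le1 (R : realType) (n : nat) (p : R) (A : {set {set 'I_n}} -> Prop) :
  0 <= p -> p <= 1 -> gnp_prob p A <= 1.
Proof.
move=> p0 p1; rewrite (gnp_prob_label p (ltnSn 0)).
rewrite -(@Pr_true R {set 'I_n} _ _ (label_weight_sum1 p (ltnSn 0))).
by apply: Pr_le => //; exact: label_weight_ge0.
Qed.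

Lemma gnp_prob_mono (R : realType) (n : nat) (p : R) (A B : {set {set 'I_n}} -> Prop) :
  0 <= p -> p <= 1 -> (forall G, A G -> B G) -> gnp_prob p A <= gnp_prob p B.
Proof.
move=> p0 p1 AB; rewrite !(gnp_prob_label p (ltnSn 0)).
by apply: Pr_le => [|f /AB //]; exact: label_weight_ge0.
Qed.

Theorem theorem1 (R : realType) (omega : nat -> R)
  (omega_infty : omega n @[n --> \oo] --> +oo)
  (omega_small : omega =o_\oo (fun n : nat => ln (n%:R : R)))
  (delta : R) (delta_gt0 : 0 < delta) :
  let p (n : nat) : R := (ln n%:R + omega n) / n%:R in
  let L (n : nat) : R := ln n%:R / ln (ln n%:R) in
  gnp_prob (p n) (fun G : {set {set 'I_n}} =>
      let M := Num.max (num_deg1 G)%:R (L n) in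
      connected_graph G /\
      (1 - delta) * M <= (rc G)%:R <= (1 + delta) * M)
    @[n --> \oo] --> (1 : R).
Proof.
move=> p L.
(* The parameter choice works for [delta] at most [1/2], and the two-sided bound is stronger for a
   smaller [delta]. *)
pose dl := Num.min delta 2^-1.
have dl0 : 0 < dl by rewrite lt_min delta_gt0 /=; lra.
have dl2 : dl <= 2^-1 by rewrite ge_min lexx orbT.
have dld : dl <= delta by rewrite ge_min lexx.
have ln_oo : ln (n%:R : R) @[n --> \oo] --> +oo by apply: cvg_ln_pinfty; exact: cvgr_idn.
have lnln_oo : ln (ln (n%:R : R)) @[n --> \oo] --> +oo by exact: cvg_ln_pinfty.
(* The first error vanishes because [omega] tends to infinity, the others because they are at most
   [n^(- dl / 2)]. *)
pose low n := 1 - (expR 1 * expR (- omega n) + 6 * expR (- (dl / 2 * ln (n%:R : R)))).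
have low_cvg : low n @[n --> \oo] --> (1 : R).
  have e1 : expR (- omega n) @[n --> \oo] --> (0 : R).
    exact: (cvg_comp _ _ omega_infty (@cvgr_expR R)).
  have dln : (dl / 2 * ln (n%:R : R)) @[n --> \oo] --> +oo.
    apply/cvgryPge => A; move/cvgryPge/(_ (A / (dl / 2))): ln_oo.
    by apply: filterS => n; rewrite ler_pdivrMr ?divr_gt0 // mulrC.
  have e2 : expR (- (dl / 2 * ln (n%:R : R))) @[n --> \oo] --> (0 : R).
    exact: (cvg_comp _ _ dln (@cvgr_expR R)).
  have : low n @[n --> \oo] --> (1 - (expR 1 * 0 + 6 * 0) : R).
    by apply: cvgB; [exact: cvg_cst | apply: cvgD; apply: cvgM => //; exact: cvg_cst].
  by rewrite !mulr0 addr0 subr0.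
apply: (squeeze_cvgr (f := low) (h := fun=> 1)); [|exact: low_cvg|exact: cvg_cst].
have est := lnln_oo _ (rc_bound_near_infinity dl0 dl2).
(* The constant 1 in the little-o gives [omega n <= ln n], hence mean degree at most [2 * ln n]. *)
have small := (eqoP _ _ _).1 omega_small 1 ltr01.
near=> n.
have ln4 : 4 < ln (n%:R : R) by near: n; move/cvgryPgt: ln_oo; exact.
have ln1 : 1 < ln (n%:R : R) by lra.
have om0 : 0 <= omega n by near: n; move/cvgryPge: omega_infty; exact.
have n0 : (0 : R) < n%:R.
  by rewrite ltNge; apply/negP => h; have := ln_le0 (le_trans h ler01); lra.
have omle : omega n <= ln n%:R.
  have : `|omega n| <= 1 * `|ln (n%:R : R)| by near: n; exact: small.
  by rewrite mul1r (ger0_norm om0) (ger0_norm (ltW (lt_trans ltr01 ln1))).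
have lnE : expR (ln (ln (n%:R : R))) = ln n%:R by rewrite lnK // posrE (lt_trans ltr01).
have estn : forall (d : R) (m : nat),
    m%:R = expR (expR (ln (ln (n%:R : R)))) -> expR (ln (ln (n%:R : R))) <= d ->
    d <= 2 * expR (ln (ln (n%:R : R))) ->
    1 - (expR (1 - (d - expR (ln (ln (n%:R : R))))) +
      6 * expR (- (dl / 2 * expR (ln (ln (n%:R : R)))))) <=
    gnp_prob (d / m%:R) (fun G : {set {set 'I_m}} =>
      let M := Num.max (num_deg1 G)%:R
        (expR (ln (ln (n%:R : R))) / ln (ln (n%:R : R))) in
      connected_graph G /\ (1 - dl) * M <= (rc G)%:R <= (1 + dl) * M).
  by near: n; exact: est.
have := estn (ln n%:R + omega n) n; rewrite lnE -/(p n) -/(L n) => {}estn.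
have p0 : 0 <= p n by rewrite /p divr_ge0 // addr_ge0 // (le_trans ler01) // ltW.
have p1 : p n <= 1.
  rewrite /p ler_pdivrMr // mul1r -[leRHS]lnK ?posrE //.
  apply: le_trans (expR_ge1Dxn 1 _); last by lra.
  by rewrite (_ : 2`!%:R = 2) // expr2; nra.
rewrite gnp_prob_le1 // andbT.
apply: (@le_trans _ _ (gnp_prob (p n) (fun G : {set {set 'I_n}} =>
      let M := Num.max (num_deg1 G)%:R (L n) in
      connected_graph G /\ (1 - dl) * M <= (rc G)%:R <= (1 + dl) * M))).
  apply: le_trans (estn _ _ _).
  - rewrite /low lerD2l lerN2 lerD2r -expRD ler_expR; lra.
  - by rewrite lnK.
  - by rewrite lerDl.
  - by rewrite mulr_natl mulr2n lerD2l.
apply: gnp_prob_mono => // G [conn /andP[lo hi]]; split=> //.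
have M0 : 0 <= Num.max (num_deg1 G)%:R (L n) by rewrite le_max ler0n.
apply/andP; split.
  by apply: le_trans lo; rewrite ler_wpM2r // lerD2l lerN2.
by apply: le_trans hi _; rewrite ler_wpM2r // lerD2l.
Unshelve. all: by end_near. Qed.
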